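(* Let $\mathcal{M}=(G,In,Out,V)$ be a linear compartmental model (with a leak in every compartment) such that either $G$ is strongly input-output connected and $|Out|=1$, or $G$ is strongly connected and $|In|=1$. Assume that $\mathcal{M}$ is an identifiable path/cycle model. Then for every $L\subseteq V$ with $In\cup Out\subseteq L$, the model $\widetilde{\mathcal{M}}=(G,In,Out,L)$ has expected dimension, i.e. the image of its coefficient map has dimension $|E|+|In\cup Out|$. In particular, if $L=In\cup Out$, then $\widetilde{\mathcal{M}}$ is locally identifiable.
   Context: A linear compartmental model $(G,In,Out,Leak)$ consists of a finite directed graph $G=(V,E)$ (no self-loops, no repeated edges) and subsets $In,Out,Leak\subseteq V$ (input, output and leak compartments; $In,Out$ nonempty). Each edge $j\to i$ carries an independent parameter $a_{ij}$ and each $i\in Leak$ an independent parameter $a_{0i}$. The compartmental matrix $A$ has $A_{ij}=a_{ij}$ if $j\to i\in E$; $A_{ii}=-a_{0i}-\sum_{k:\,i\to k\in E}a_{ki}$ if $i\in Leak$; $A_{ii}=-\sum_{k:\,i\to k\in E}a_{ki}$ if $i\notin Leak$; all other entries $0$. The model is the system $x'=Ax+u$, $y_i=x_i$ for $i\in Out$, with $u_i\equiv 0$ for $i\notin In$. When $Leak=V$, the diagonal entries $a_{ii}:=A_{ii}$ are algebraically independent and are used as parameters in place of the $a_{0i}$. When every vertex has a directed path to every output (which holds under the hypotheses here), the input-output equation for $j\in Out$ is $\det(\partial I-A)\,y_j=\sum_{i\in In}(-1)^{i+j}\det(\partial I-A)_{ij}\,u_i$, where $\partial=d/dt$ and $(\cdot)_{ij}$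 means delete row $i$ and column $j$. The coefficient map $c:\mathbb{R}^{|E|+|Leak|}\to\mathbb{R}^k$ collects all nonzero, nonmonic coefficients (polynomials in the parameters) of these equations over all $j\in Out$. A cycle is a closed directed path with no repeated vertices; to a cycle or directed path associate the monomial that is the product of the parameters of its edges. The diagonal entries $a_{ii}$ count as monomial cycles of length 1 (self-cycles). $G$ is strongly input-output connected if it is connected (as an undirected graph) and every edge lies in a cycle or in a directed path from an input vertex to an output vertex. A function $f$ of the parameters is locally identifiable (from $c$) if there is a finitely multivalued function $\Phi$ with $\Phi\circ c=f$ (generically). A model $(G,In,Out,V)$ is an identifiable path/cycle model if all of the independent monomial cycles (including self-cycles) and monomial paths from input to output are locally identifiable and each parameter is contained in such a cycle or path. A model is (generically) locally identifiable if, outside a set of measure zero in parameter space, every point has a neighborhood on which $c$ is one-to-one; equivalently, the Jacobian of $c$ has rank $|E|+|Leak|$ at a generic point. *)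

(* Defs.v *)
From HB Require Import structures.
From mathcomp Require Import all_boot all_order all_algebra.
From mathcomp Require Import classical_sets reals topology normedtype.
(* The notations of mpoly clash with those of mathcomp-analysis. *)
From mathcomp Require Import -(notations) mpoly.

Set Implicit Arguments.
Unset Strict Implicit.
Unset Printing Implicit Defensive.

Import Order.TTheory GRing.Theory Num.Theory.
Import numFieldNormedType.Exports.

Local Open Scope ring_scope.
Local Open Scope classical_set_scope.

Notation "{ 'mpoly' T [ n ] }" := (mpoly.mpoly n T)
  (at level 0, T at level 2, format "{ 'mpoly'  T [ n ] }") : type_scope.
Local Notation "''X_' i" := (mpoly.mpolyX _ (mpoly.mnm1 i))
  (at level 8, i at level 2, format "''X_' i").
Local Notation "p \mPo q" := (mpoly.comp_mpoly q p) (at level 50).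

Section Graph.

(* A directed graph on 'I_n is its set of edges: (j, i) \in G is the edge
   j -> i. *)
Variables (n : nat) (G : {set 'I_n * 'I_n}).

Definition loopless : Prop := forall i, (i, i) \notin G.

Definition arc_rel : rel 'I_n := [rel x y | (x, y) \in G].

Definition strongly_connected : Prop := forall x y, connect arc_rel x y.

Definition weakly_connected : Prop :=
  forall x y, connect [rel u v | arc_rel u v || arc_rel v u] x y.

(* The consecutive pairs of the sequence x :: s. *)
Definition walk_edges (x : 'I_n) (s : seq 'I_n) : seq ('I_n * 'I_n) :=
  zip (x :: s) s.

Definition is_cycle (es : seq ('I_n * 'I_n)) : Prop :=
  exists x s, [/\ cycle arc_rel (x :: s), uniq (x :: s)
                & es = walk_edges x (rcons s x)].

Definition is_io_path (In Out : {set 'I_n}) (es : seq ('I_n * 'I_n)) : Prop :=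
  exists x s, [/\ path arc_rel x s, uniq (x :: s), x \in In,
                  last x s \in Out & es = walk_edges x s].

Definition edges_covered (In Out : {set 'I_n}) : Prop :=
  forall e, e \in G ->
    exists2 es, is_cycle es \/ is_io_path In Out es & e \in es.

Definition strongly_io_connected (In Out : {set 'I_n}) : Prop :=
  weakly_connected /\ edges_covered In Out.

End Graph.

Section RealSpace.

Variable R : realType.

Definition measure_zero N (S : set 'rV[R]_N) : Prop :=
  forall eps : R, 0 < eps ->
  exists (D : pred nat) (a b : nat -> 'rV[R]_N),
    [/\ forall k i, a k 0 i <= b k 0 i,
        S `<=` [set x : 'rV[R]_N |
                 exists2 k, D k & forall i, a k 0 i <= x 0 i <= b k 0 i]
      & forall m, \sum_(k < m | D k) \prod_i (b k 0 i - a k 0 i) <= eps].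

Definition generically N (P : set 'rV[R]_N) : Prop :=
  measure_zero [set x : 'rV[R]_N | ~ P x].

Definition indep_coordinates k (S : set 'rV[R]_k) d (f : 'I_d -> 'I_k) : Prop :=
  forall Q : {mpoly R[d]},
    (forall y, S y -> meval (fun i => y 0 (f i)) Q = 0) -> Q = 0.

(* The dimension of the Zariski closure of S: the largest number of coordinates
   that are algebraically independent modulo the vanishing ideal of S. *)
Definition has_dimension k (S : set 'rV[R]_k) (d : nat) : Prop :=
  (exists f : 'I_d -> 'I_k, indep_coordinates S f) /\
  (forall d' (f : 'I_d' -> 'I_k), indep_coordinates S f -> (d' <= d)%N).

Definition alg_independent N d (B : d.-tuple {mpoly R[N]}) : Prop :=
  forall Q : {mpoly R[d]}, Q \mPo B = 0 -> Q = 0.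

End RealSpace.

Section Model.

Variables (R : realType) (n : nat) (G : {set 'I_n * 'I_n}).
Variables (In Out Leak : {set 'I_n}).

(* An edge parameter for each element of G and a leak parameter for each
   element of Leak. *)
Definition param : finType := ({e | e \in G} + {i | i \in Leak})%type.

Definition nparam : nat := #|{: param}|.

Definition ppoly := {mpoly R[nparam]}.

Definition pvar (u : param) : ppoly := 'X_(enum_rank u).

(* For e = (j, i), this is a_ij. *)
Definition edge_param (e : 'I_n * 'I_n) : ppoly :=
  if insub e is Some u then pvar (inl u) else 0.

Definition leak_param (i : 'I_n) : ppoly :=
  if insub i is Some u then pvar (inr u) else 0.

Definition compartmental_mx : 'M[ppoly]_n :=
  \matrix_(i, j)
    if i == j then - leak_param i - \sum_(k | (i, k) \in G) edge_param (i, k)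
    else edge_param (j, i).

(* With 'X for the derivation, cofactor _ i j is the signed minor
   (-1)^(i+j) det('X I - A)_ij. *)
Definition io_coefs (j : 'I_n) : seq ppoly :=
  char_poly compartmental_mx ++
  flatten [seq (cofactor (char_poly_mx compartmental_mx) i j : seq ppoly)
          | i <- enum In].

(* A coefficient equal to 1 is the leading one of det('X I - A), or of
   det('X I - A)_jj when j is both an input and an output. *)
Definition coefs : seq ppoly :=
  [seq q <- flatten [seq io_coefs j | j <- enum Out] | (q != 0) && (q != 1)].

Definition coef_map (p : 'rV[R]_nparam) : 'rV[R]_(size coefs) :=
  \row_l meval (fun u => p 0 u) coefs`_l.

Definition expected_dimension : Prop :=
  has_dimension (range coef_map) (#|G| + #|In :|: Out|).

Definition locally_identifiable : Prop :=
  generically [set p : 'rV[R]_nparam | exists2 U, nbhs p U &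
    forall q r, U q -> U r -> coef_map q = coef_map r -> q = r].

Definition locally_identifiable_fun (f : 'rV[R]_nparam -> R) : Prop :=
  exists Phi : 'rV[R]_(size coefs) -> seq R,
    generically [set p : 'rV[R]_nparam | f p \in Phi (coef_map p)].

(* The self-cycles are the diagonal entries of the compartmental matrix. *)
Definition path_cycle_monomial (m : ppoly) : Prop :=
  (exists i, m = compartmental_mx i i) \/
  (exists2 es, is_cycle G es \/ is_io_path G In Out es
             & m = \prod_(e <- es) edge_param e).

Definition max_independent d (B : d.-tuple ppoly) : Prop :=
  [/\ forall m, m \in B -> path_cycle_monomial m,
      alg_independent B
    & forall m, path_cycle_monomial m -> ~ alg_independent [tuple of m :: B]].

End Model.

(* There is a leak in every compartment.  The parameters of the monomials are
   then the a_ij (j -> i an edge) and the a_ii, and each a_ii is its own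
   self-cycle, so only the edges have to be covered. *)
Definition identifiable_path_cycle_model (R : realType) n
    (G : {set 'I_n * 'I_n}) (In Out : {set 'I_n}) : Prop :=
  (exists d (B : d.-tuple (ppoly R G [set: 'I_n]%SET)),
     max_independent In Out B /\
     forall m, m \in B ->
       locally_identifiable_fun In Out (fun p => meval (fun u => p 0 u) m)) /\
  edges_covered G In Out.

(* Main.v *)
Require Import Defs.
From HB Require Import structures.
From mathcomp Require Import all_boot all_order all_algebra.
From mathcomp Require finmap.
From mathcomp Require Import classical_sets boolp functions.
From mathcomp Require Import interval_inference reals topology normedtype sequences.
From mathcomp Require Import -(notations) mpoly.
From mathcomp Require Import ring lra.

(** Put S = In ∪ Out, let W be its complement, and let V be the set of all
    compartments.

    Conjugating a compartmental matrix A by a positive diagonal matrix D with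
    D i = 1 for i in S changes neither its characteristic polynomial nor the
    cofactors indexed by an input and an output.  If A has a positive leak in
    every compartment, then D can be chosen so that every column of D A D^-1
    outside S sums to 0, that is, so that only the leaks in S survive: this is
    a linear system for D, solvable and with a positive solution by the
    maximum principle, because every vertex has a path to S
    (balancing_weights).  Hence a polynomial relation among coefficients which
    holds for the model with leaks in S holds for the model with all leaks;
    conversely, relations restrict from V to L and from L to S by setting
    leaks to 0.  So for every L between S and V, the same families of
    coefficients are algebraically independent (label_indep_subset,
    label_indep_transfer), and the dimension of the model does not depend on
    L.  It is at most #|G| + #|S|, the number of parameters of the model with
    leaks in S.

    That it is at least #|G| + #|S| is proved for L = V, by bounding the kernel
    of the Jacobian J of the coefficients over the field of rational functions
    (full_rank).  Let v be in this kernel and let D_v be the derivation of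
    direction v.  If m is a locally identifiable monomial, then m is algebraic
    over the coefficients, so D_v m = 0 (deriv_algdep); as every path or cycle
    monomial is algebraic over a maximal independent set of such m, it is also
    killed by D_v.  Thus the logarithmic derivatives w e = D_v (a_e) / a_e of
    the edge parameters sum to 0 along each cycle and each path from input to
    output.  The graph becomes strongly connected when an edge is added from
    each output to each input, so w is the coboundary of a potential which
    vanishes on S (potential).  The potential determines v, whence
    dim ker J <= #|W|, and J has rank at least
    (#|G| + #|V|) - #|W| = #|G| + #|S|.

    Identifiability is stated with an arbitrary finitely multivalued function
    Phi and an exceptional null set; that it implies algebraic dependence is
    the analytic part of the proof (finitely_valued_algdep).  If m were
    transcendental over the coefficients c, a transcendence basis of c together
    with m could be completed to a polynomial map F from R^N to R^N with nonzero
    Jacobian, which is bi-Lipschitz and open near some point.  As null sets are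
    preserved by such maps and by translations, there are infinitely many points
    outside the exceptional set where the basis of c takes the same values
    and m takes distinct values.  The other coefficients are algebraic over the
    basis, so c takes finitely many values at these points, and Phi o c cannot
    contain all the values of m.

    Finally, the model with leaks in S has #|G| + #|S| independent coefficients
    and as many parameters, so their Jacobian determinant is a nonzero
    polynomial (algindep_extend); where it does not vanish, which is
    almost everywhere, the coefficient map is locally injective
    (evmap_expansive). *)

Set Implicit Arguments.
Unset Strict Implicit.
Unset Printing Implicit Defensive.

Import Order.TTheory GRing.Theory Num.Theory.
Import numFieldNormedType.Exports.

Local Open Scope ring_scope.

Local Notation "''X_' i" := (mpoly.mpolyX _ (mpoly.mnm1 i))
  (at level 8, i at level 2, format "''X_' i").
Local Notation "p .@[ v ]" := (meval v p)
  (at level 1, left associativity, format "p .@[ v ]").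
Local Notation msize p := (@mmeasure _ _ (@mdeg _) p).
Local Notation "x %:F" := (tofrac x).

(** * Algebraic independence of polynomials and their Jacobians *)

Section Algebra.
Variable R : numFieldType.

Lemma mpoly_ring_ind n (P : {mpoly R[n]} -> Prop) :
  (forall c, P (mpolyC n c)) -> (forall i, P 'X_i) ->
  (forall p q, P p -> P q -> P (p + q)) ->
  (forall p q, P p -> P q -> P (p * q)) -> forall p, P p.
Proof.
move=> PC PX PD PM; elim/mpolyind => [|c m p _ _ Pp]; first by rewrite -mpolyC0.
apply: PD => //; rewrite -mul_mpolyC; apply: (PM) => //.
rewrite mpolyXE_id; apply: (big_ind P) => [|p1 p2|i _]; [by rewrite -mpolyC1|exact: PM|].
elim: (m i) => [|k IH]; first by rewrite expr0 -mpolyC1.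
by rewrite exprS; apply: PM.
Qed.

Lemma mderiv_var N (i j : 'I_N) : mderiv j ('X_i : {mpoly R[N]}) = (i == j)%:R.
Proof.
rewrite mderivX mnm1E; case: eqVneq => [->|_]; last by rewrite scale0r.
have -> : mnm_sub (mnm1 j) (mnm1 j) = mnm0 by apply/mnmP=> k; rewrite mnmBE subnn mnm0E.
by rewrite mpolyX0 scale1r.
Qed.

(** Substitution of the polynomials f i for the variables of Q. *)
Definition subst d N (f : 'I_d -> {mpoly R[N]}) (Q : {mpoly R[d]}) :=
  comp_mpoly [tuple f i | i < d] Q.

Section Subst.
Variables (d N : nat) (f : 'I_d -> {mpoly R[N]}).

Lemma substC c : subst f (mpolyC d c) = mpolyC N c.
Proof. exact: comp_mpolyC. Qed.
Lemma substX i : subst f 'X_i = f i.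
Proof. by rewrite /subst comp_mpolyXU -tnth_nth tnth_mktuple. Qed.
Lemma substD : {morph subst f : p q / p + q}.
Proof. exact: comp_mpolyD. Qed.
Lemma substB : {morph subst f : p q / p - q}.
Proof. exact: comp_mpolyB. Qed.
Lemma substM : {morph subst f : p q / p * q}.
Proof. by move=> p q; rewrite /subst rmorphM. Qed.
Lemma subst0 : subst f 0 = 0.
Proof. exact: comp_mpoly0. Qed.
Lemma meval_subst v Q : (subst f Q).@[v] = Q.@[fun i => (f i).@[v]].
Proof. by rewrite /subst comp_mpoly_meval; apply: meval_eq => i; rewrite tnth_mktuple. Qed.

Lemma mderiv_subst j Q :
  mderiv j (subst f Q) = \sum_i subst f (mderiv i Q) * mderiv j (f i).
Proof.
elim/mpoly_ring_ind: Q => [c|i|p q IHp IHq|p q IHp IHq].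
- by rewrite substC mderivC big1 // => i _; rewrite mderivC subst0 mul0r.
- rewrite substX (bigD1 i) //= big1 ?addr0 => [|k ki]; rewrite mderiv_var.
    by rewrite eqxx -mpolyC1 substC mpolyC1 mul1r.
  by rewrite eq_sym (negPf ki) subst0 mul0r.
- rewrite substD mderivD IHp IHq -big_split; apply: eq_bigr => i _ /=.
  by rewrite mderivD substD mulrDl.
rewrite substM mderivM IHp IHq mulr_suml mulr_sumr -big_split.
apply: eq_bigr => i _ /=; rewrite mderivM substD !substM mulrDl mulrA.
by rewrite -!mulrA; congr (_ * _ + _ * _); rewrite mulrC.
Qed.
End Subst.

Lemma eq_subst d N (f g : 'I_d -> {mpoly R[N]}) Q : f =1 g -> subst f Q = subst g Q.
Proof. by move=> fg; rewrite /subst; congr comp_mpoly; apply: eq_mktuple. Qed.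

Lemma subst_subst d e N (f : 'I_d -> {mpoly R[e]}) (g : 'I_e -> {mpoly R[N]}) Q :
  subst g (subst f Q) = subst (fun i => subst g (f i)) Q.
Proof.
elim/mpoly_ring_ind: Q => [c|i|p q IHp IHq|p q IHp IHq].
- by rewrite !substC.
- by rewrite !substX.
- by rewrite !substD IHp IHq.
- by rewrite !substM IHp IHq.
Qed.

Lemma subst_id d (Q : {mpoly R[d]}) : subst (fun i => 'X_i) Q = Q.
Proof.
elim/mpoly_ring_ind: Q => [c|i|p q IHp IHq|p q IHp IHq].
- by rewrite !substC.
- by rewrite !substX.
- by rewrite !substD IHp IHq.
- by rewrite !substM IHp IHq.
Qed.

(** Algebraic independence over R of a finite family of polynomials. *)
Definition algindep d N (f : 'I_d -> {mpoly R[N]}) :=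
  forall Q, subst f Q = 0 -> Q = 0.

(** The family m, f 0, f 1, ..., with m at index 0. *)
Definition fcons d N (m : {mpoly R[N]}) (f : 'I_d -> {mpoly R[N]}) (i : 'I_d.+1) :=
  if unlift ord0 i is Some j then f j else m.

Lemma fcons0 d N m (f : 'I_d -> {mpoly R[N]}) : fcons m f ord0 = m.
Proof. by rewrite /fcons unlift_none. Qed.
Lemma fconsS d N m (f : 'I_d -> {mpoly R[N]}) i : fcons m f (lift ord0 i) = f i.
Proof. by rewrite /fcons liftK. Qed.

Lemma mderiv_lt d (Q : {mpoly R[d]}) i : Q != 0 -> (msize (mderiv i Q) < msize Q)%N.
Proof.
move=> Q0; case: (eqVneq (mderiv i Q) 0) => [->|D0].
  by rewrite msize0 lt0n msize_poly_eq0.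
rewrite -(mlead_deg D0).
have := mlead_supp D0; rewrite mcoeff_msupp mcoeff_deriv => H.
have H2 : mnm_add (mlead (mderiv i Q)) (mnm1 i) \in msupp Q.
  by rewrite mcoeff_msupp; apply: contraNneq H => ->; rewrite mul0rn.
apply: leq_trans (msize_mdeg_lt H2); by rewrite mdegD mdeg1 addn1.
Qed.

Lemma mderiv_eq0_coef d (Q : {mpoly R[d]}) i (m : multinom d) :
  mderiv i Q = 0 -> m i != 0%N -> mcoeff m Q = 0.
Proof.
move=> D0 mi; have := mcoeff_deriv i (mnm_sub m (mnm1 i)) Q.
rewrite D0 mcoeff0 submK; last by rewrite lep1mP.
by move/esym/eqP; rewrite mulrn_eq0 => /eqP.
Qed.

(** In characteristic 0 only the constants have a null gradient. *)
Lemma mderiv_all0 d (Q : {mpoly R[d]}) : (forall i, mderiv i Q = 0) ->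
  Q = mpolyC d (mcoeff (@mnm0 d) Q).
Proof.
move=> D0; apply/mpolyP => m; rewrite mcoeffC.
case: (eqVneq m (@mnm0 d)) => [->|m0]; first by rewrite mulr1.
rewrite mulr0; have [i mi] : exists i, m i != 0%N.
  apply/existsP; apply: contraNT m0; rewrite negb_exists => /forallP H.
  by apply/eqP/mnmP => i; rewrite mnm0E; apply/eqP; have := H i; rewrite negbK.
exact: mderiv_eq0_coef (D0 i) mi.
Qed.

(** A polynomial whose derivative in a variable is 0 does not involve this
    variable. *)
Lemma subst_mderiv0 d N (f g : 'I_d -> {mpoly R[N]}) (Q : {mpoly R[d]}) i :
  mderiv i Q = 0 -> (forall j, j != i -> f j = g j) -> subst f Q = subst g Q.
Proof.
move=> D0 fg; rewrite /subst !comp_mpolyEX !big_seq; apply: eq_bigr => m mQ.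
rewrite !comp_mpolyX; congr (_ *: _); apply: eq_bigr => j _; rewrite !tnth_mktuple.
case: (eqVneq j i) => [->|/fg -> //].
have -> : m i = 0%N; last by rewrite !expr0.
apply/eqP; apply: contraTT mQ => mi.
by rewrite mcoeff_msupp negbK; apply/eqP; apply: mderiv_eq0_coef D0 mi.
Qed.

Lemma ex_min_msize d (P : {mpoly R[d]} -> Prop) Q : P Q ->
  exists Q0, P Q0 /\ forall Q1, P Q1 -> (msize Q0 <= msize Q1)%N.
Proof.
have [k] := ubnP (msize Q); elim: k Q => // k IH Q szQ PQ.
have [[Q' [PQ' lt]]|H] := pselect (exists Q', P Q' /\ (msize Q' < msize Q)%N).
  by apply: IH PQ'; exact: leq_trans lt szQ.
exists Q; split=> // Q1 PQ1; rewrite leqNgt; apply/negP => lt; apply: H; by exists Q1.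
Qed.

(** If m is algebraic over the independent family f, then its gradient is a
    combination of those of f over the field of fractions: differentiate a
    relation Q (m, f) = 0 of least degree. *)
Lemma algdep_gradient d N (f : 'I_d -> {mpoly R[N]}) m :
  algindep f -> ~ algindep (fcons m f) ->
  exists g : {mpoly R[N]}, exists2 w : 'I_d -> {mpoly R[N]}, g != 0 &
    forall j, g * mderiv j m = \sum_l w l * mderiv j (f l).
Proof.
move=> indf depm.
have [Q [Q0 fQ]] : exists Q, Q != 0 /\ subst (fcons m f) Q = 0.
  apply: contrapT => H; apply: depm => Q fQ; apply: contrapT => /eqP Q0.
  by apply: H; exists Q.
have [{Q0 fQ}Q [[Q0 fQ] minQ]] :=
  @ex_min_msize _ (fun Q => Q != 0 /\ subst (fcons m f) Q = 0) Q (conj Q0 fQ).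
(* Minimality: the derivatives of Q are not relations unless they vanish. *)
have min0 i : subst (fcons m f) (mderiv i Q) = 0 -> mderiv i Q = 0.
  move=> H; apply: contrapT => /eqP D0.
  by have := minQ _ (conj D0 H); rewrite leqNgt mderiv_lt.
exists (subst (fcons m f) (mderiv ord0 Q)).
exists (fun l => - subst (fcons m f) (mderiv (lift ord0 l) Q)).
  apply: contraNneq Q0 => /min0 D0.
  (* Otherwise Q does not involve its variable 0, so it is a relation for f. *)
  pose h (i : 'I_d.+1) : {mpoly R[d]} := if unlift ord0 i is Some j then 'X_j else 0.
  pose emb (i : 'I_d) : {mpoly R[d.+1]} := 'X_(lift ord0 i).
  have HQ : subst h Q = 0.
    apply: indf; rewrite subst_subst -fQ; apply: (@subst_mderiv0 _ _ _ _ _ ord0) => // j.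
    rewrite eq_sym => /unlift_some [k -> _]; by rewrite fconsS /h liftK substX.
  rewrite -(subst_id Q) (@subst_mderiv0 _ _ _ (fun i => subst emb (h i)) _ ord0) //.
    by rewrite -subst_subst HQ subst0.
  move=> j; rewrite eq_sym => /unlift_some [k -> _]; by rewrite /h liftK substX.
move=> j; have := congr1 (mderiv j) fQ.
rewrite mderiv_subst mderiv0 big_ord_recl fcons0 => /eqP.
rewrite addr_eq0 => /eqP ->; rewrite -sumrN; apply: eq_bigr => l _.
by rewrite fconsS mulNr.
Qed.

Lemma msizeM_leS N (p q : {mpoly R[N]}) a b :
  (msize p <= a.+1)%N -> (msize q <= b.+1)%N -> (msize (p * q) <= (a + b).+1)%N.
Proof.
have [->|p0] := eqVneq p 0; first by rewrite mul0r msize0.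
have [->|q0] := eqVneq q 0; first by rewrite mulr0 msize0.
rewrite msizeM // (mpolySpred _ p0) (mpolySpred _ q0) !ltnS addSn addnS /= => *.
exact: leq_add.
Qed.

Lemma msize_exp_le N (p : {mpoly R[N]}) D k :
  (msize p <= D.+1)%N -> (msize (p ^+ k) <= (k * D).+1)%N.
Proof.
move=> Hp; elim: k => [|k IH]; first by rewrite expr0 msize1.
by rewrite exprS mulSn; exact: msizeM_leS.
Qed.

Lemma msize_prod_le N (I : finType) (p : I -> {mpoly R[N]}) (D : I -> nat) :
  (forall i, msize (p i) <= (D i).+1)%N ->
  (msize (\prod_i p i) <= (\sum_i D i).+1)%N.
Proof.
move=> Hp; elim/big_rec2: _ => [|i y x _ IH]; first by rewrite msize1.
exact: msizeM_leS.
Qed.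

(** More than N polynomials in N variables are dependent.  The K ^ d monomials
    in f with all exponents less than K have degree at most d * D * K, so all
    their exponents are less than C * K; for d > N and K > C ^ N, they are more
    numerous than the (C * K) ^ N monomials on which they are supported. *)
Lemma algindep_leq d N (f : 'I_d -> {mpoly R[N]}) : algindep f -> (d <= N)%N.
Proof.
move=> indf; rewrite leqNgt; apply/negP => ltNd.
pose D := (\max_i (msize (f i) : nat))%N.
have fD i : (msize (f i) <= D.+1)%N by rewrite /D; apply: leqW; exact: leq_bigmax.
pose C := (d * D).+1%N; pose K := (C ^ N).+1%N.
pose row := {ffun 'I_d -> 'I_K}; pose colT := {ffun 'I_N -> 'I_(C * K)%N}.
pose mr (a : row) : multinom d := Multinom [tuple (a i : nat) | i < d].
pose mc (b : colT) : multinom N := Multinom [tuple (b i : nat) | i < N].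
pose M : 'M[R]_(#|{: row}|, #|{: colT}|) :=
  \matrix_(a, b) mcoeff (mc (enum_val b)) (subst f (mpolyX R (mr (enum_val a)))).
have cardlt : (#|{: colT}| < #|{: row}|)%N.
  rewrite !card_ffun !card_ord.
  apply: (@leq_trans (K ^ N.+1)%N); last by rewrite leq_pexp2l.
  by rewrite expnMn expnS ltn_pmul2r // expn_gt0.
have /rowV0Pn [u uM u0] : kermx M != 0.
  rewrite kermx_eq0 /row_free; apply/eqP => rM.
  by have := rank_leq_col M; rewrite rM leqNgt cardlt.
pose Q : {mpoly R[d]} := \sum_a u 0 a *: (mpolyX R (mr (enum_val a))).
have mr_inj : injective mr.
  move=> a b /mnmP H; apply/ffunP => i; apply/val_inj.
  by have := H i; rewrite !mnmE.
have Q0 : Q = 0.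
  apply: indf; rewrite /Q /subst raddf_sum /=.
  apply/mpolyP => m; rewrite mcoeff0.
  have [/forallP mlt|] := boolP [forall i, m i < C * K]%N.
    pose b : colT := [ffun i => Ordinal (mlt i)].
    have -> : m = mc b by apply/mnmP => i; rewrite mnmE ffunE.
    have := sub_kermxP uM => /matrixP /(_ 0 (enum_rank b)); rewrite !mxE => E.
    rewrite raddf_sum /= -[RHS]E; apply: eq_bigr => a _.
    by rewrite comp_mpolyZ mcoeffZ mxE enum_rankK.
  rewrite negb_forall => /existsP [i]; rewrite -leqNgt => mi.
  apply: memN_msupp_eq0; apply: contraL mi => mQ; rewrite -ltnNge.
  apply: (@leq_ltn_trans (mdeg m)).
    by rewrite mdegE (bigD1 i) //= leq_addr.
  apply: leq_trans (msize_mdeg_lt mQ) _.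
  apply: leq_trans (msize_sum _ _ _) _; apply/bigmax_leqP => a _.
  rewrite comp_mpolyZ; apply: leq_trans (msizeZ_le _ _) _.
  rewrite comp_mpolyX.
  apply: (@leq_trans (\sum_(i < d) mr (enum_val a) i * D).+1%N).
    by apply: msize_prod_le => k; rewrite tnth_mktuple; exact: msize_exp_le.
  apply: (@leq_ltn_trans (\sum_(i < d) (C ^ N) * D)%N).
    apply: leq_sum => k _; rewrite leq_mul2r mnmE; apply/orP; right.
    by rewrite -ltnS ltn_ord.
  rewrite sum_nat_const card_ord mulnCA mulnC {2}/C /K.
  by rewrite mulSn mulnS addSn ltnS addnA leq_addl.
case/eqP: u0; apply/rowP => a; rewrite mxE.
have := congr1 (mcoeff (mr (enum_val a))) Q0; rewrite mcoeff0 /Q raddf_sum /=.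
rewrite (bigD1 a) //= mcoeffZ mcoeffX eqxx mulr1 big1 ?addr0 // => b ba.
rewrite mcoeffZ mcoeffX; case: eqP => [/mr_inj/enum_val_inj E|]; last by rewrite mulr0.
by rewrite E eqxx in ba.
Qed.

Lemma eq_algindep d N (f g : 'I_d -> {mpoly R[N]}) : f =1 g -> algindep f -> algindep g.
Proof. by move=> fg indf Q gQ; apply: indf; rewrite (eq_subst _ fg). Qed.

Lemma algindep_nil N (f : 'I_0 -> {mpoly R[N]}) : algindep f.
Proof.
move=> Q; rewrite (nvar0_mpolyC Q) substC => /eqP.
by rewrite mpolyC_eq0 => /eqP ->; rewrite mpolyC0.
Qed.

Lemma max_algindep_subfamily k N (c : 'I_k -> {mpoly R[N]}) :
  exists r (s : 'I_r -> 'I_k), algindep (c \o s) /\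
    forall l, ~ algindep (fcons (c l) (c \o s)).
Proof.
suff H m r (s : 'I_r -> 'I_k) : (N - r <= m)%N -> algindep (c \o s) ->
    exists r (s : 'I_r -> 'I_k), algindep (c \o s) /\
    forall l, ~ algindep (fcons (c l) (c \o s)).
  have s0 : 'I_0 -> 'I_k by case.
  exact: (H N 0%N s0 (leq_subr _ _) (@algindep_nil _ _)).
elim: m r s => [|m IH] r s rm ind.
  exists r, s; split=> // l /algindep_leq.
  by rewrite leqNgt ltnS -subn_eq0 -leqn0 rm.
have [[l indl]|H] := pselect (exists l, algindep (fcons (c l) (c \o s))); last first.
  by exists r, s; split=> // l indl; apply: H; exists l.
apply: (IH r.+1 (fun i => if unlift ord0 i is Some j then s j else l)).
  by rewrite subnS -subn1 leq_subLR add1n.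
by apply: eq_algindep indl => i; rewrite /fcons /=; case: unliftP.
Qed.

(** The Jacobian matrix; row i is the gradient of f i. *)
Definition jac d N (f : 'I_d -> {mpoly R[N]}) : 'M[{mpoly R[N]}]_(d, N) :=
  \matrix_(i, j) mderiv j (f i).

Local Notation fracjac f := (map_mx (@tofrac _) (jac f)).

(** An independent family extends, by variables, to N polynomials in N variables
    with nonzero Jacobian determinant.  When no variable can be added, all are
    algebraic over f, so the gradients of f span the whole space. *)
Lemma algindep_extend d N (f : 'I_d -> {mpoly R[N]}) : algindep f ->
  exists (F : 'I_N -> {mpoly R[N]}) (s : 'I_d -> 'I_N),
    [/\ forall i, F (s i) = f i, injective s & \det (jac F) != 0].
Proof.
have [m] := ubnP (N - d)%N; elim: m d f => // m IH d f; rewrite ltnS => dm indf.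
have [[i indi]|H] := pselect (exists i, algindep (fcons 'X_i f)).
  have ltdN := algindep_leq indi.
  have [|F [s [Fs sinj detF]]] := IH _ _ _ indi.
    by apply: leq_trans dm; rewrite subnS prednK // subn_gt0.
  exists F, (s \o lift ord0); split=> // [j|].
    by rewrite /= Fs fconsS.
  by apply: inj_comp => //; exact: lift_inj.
have /choice [g /choice [w gw]] : forall i : 'I_N, exists g : {mpoly R[N]},
    exists w : 'I_d -> {mpoly R[N]}, g != 0 /\
    forall j, g * mderiv j 'X_i = \sum_l w l * mderiv j (f l).
  move=> i; have [|g [w g0 E]] := algdep_gradient (m := 'X_i) indf; last by exists g, w.
  by move=> indi; apply: H; exists i.
pose W := \matrix_(i, l) w i l.
have WJ : W *m jac f = diag_mx (\row_i g i).
  apply/matrixP => i j; rewrite !mxE (eq_bigr (fun l => w i l * mderiv j (f l))).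
    by rewrite -(gw i).2 mderiv_var mulr_natr.
  by move=> l _; rewrite !mxE.
have detD : \det (diag_mx (\row_i g i)) != 0.
  rewrite det_diag; apply/prodf_neq0 => i _; rewrite mxE; exact: (gw i).1.
have leNd : (N <= d)%N.
  have rD : \rank (map_mx (@tofrac _) (W *m jac f)) = N.
    apply/eqP; rewrite WJ -/(row_free _) row_free_unit unitmxE unitfE.
    by rewrite det_map_mx tofrac_eq0.
  by rewrite -rD map_mxM; apply: leq_trans (mxrankM_maxl _ _) (rank_leq_col _).
have eqdN : d = N by apply/eqP; rewrite eqn_leq leNd (algindep_leq indf).
subst d; exists f, id; split=> //.
by apply: contraNneq detD => D0; rewrite -WJ det_mulmx D0 mulr0.
Qed.

(** A relation of least degree among the f i would give, by the chain rule, a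
    linear relation between their gradients. *)
Lemma jac_free_algindep d N (f : 'I_d -> {mpoly R[N]}) :
  row_free (fracjac f) -> algindep f.
Proof.
move=> free; suff H : ~ exists Q, Q != 0 /\ subst f Q = 0.
  by move=> Q fQ; apply: contrapT => /eqP Q0; apply: H; exists Q.
case=> Q1 HQ1.
have [Q [[Q0 fQ] minQ]] :=
  @ex_min_msize _ (fun Q => Q != 0 /\ subst f Q = 0) Q1 HQ1.
have D0 i : mderiv i Q = 0.
  apply: contrapT => /eqP Di0.
  suff Z : subst f (mderiv i Q) = 0 by have := minQ _ (conj Di0 Z); rewrite leqNgt mderiv_lt.
  pose w := \row_l subst f (mderiv l Q).
  have /(congr1 (map_mx (@tofrac _))) : w *m jac f = 0.
    apply/matrixP => a j; rewrite [RHS]mxE -[RHS](mderiv0 R j) -[in RHS]fQ.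
    rewrite mderiv_subst mxE.
    by apply: eq_bigr => l _; rewrite !mxE.
  rewrite map_mxM map_mx0 => /eqP; rewrite mulmx_free_eq0 // => /eqP/matrixP/(_ 0 i).
  by rewrite !mxE => /eqP; rewrite tofrac_eq0 => /eqP.
case/eqP: Q0; have := fQ; rewrite (mderiv_all0 D0) substC => /eqP.
by rewrite mpolyC_eq0 => /eqP ->; rewrite mpolyC0.
Qed.

End Algebra.

(** * Polynomial maps near a point of invertible Jacobian *)

(** Real matrices with the supremum norm form a Banach space. *)
HB.instance Definition _ (R : realType) m n := Complete.on 'M[R]_(m, n).

Section Analysis.
Variable R : realType.

Lemma coord_le_norm N (x : 'rV[R]_N) i : `|x 0 i| <= `|x|.
Proof.
rewrite [leRHS]/Num.norm /= mx_normrE; apply/bigmax_geP; right.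
by exists (0, i).
Qed.

Lemma norm_rV_le N (x : 'rV[R]_N) c : 0 <= c -> (forall i, `|x 0 i| <= c) -> `|x| <= c.
Proof.
move=> c0 H; rewrite [leLHS]/Num.norm /= mx_normrE; apply/bigmax_leP; split=> // -[a i] _ /=.
by rewrite (ord1 a).
Qed.

(** The value of a polynomial at a row vector. *)
Definition ev N (P : {mpoly R[N]}) (x : 'rV[R]_N) : R := P.@[fun i => x 0 i].

Definition grad N (P : {mpoly R[N]}) (p : 'rV[R]_N) : 'rV[R]_N :=
  \row_j ev (mderiv j P) p.

Definition dotp N (u v : 'rV[R]_N) : R := \sum_j u 0 j * v 0 j.

Lemma dotp_bound N (u v : 'rV[R]_N) : `|dotp u v| <= (\sum_j `|u 0 j|) * `|v|.
Proof.
apply: le_trans (ler_norm_sum _ _ _) _; rewrite mulr_suml; apply: ler_sum => j _.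
by rewrite normrM ler_wpM2l // coord_le_norm.
Qed.

(** Strict differentiability of P at p, with derivative given by the formal
    gradient.  Unlike Frechet differentiability, it compares any two points
    near p, so it makes polynomial maps with invertible Jacobian bi-Lipschitz. *)
Definition strict_diff N (P : {mpoly R[N]}) (p : 'rV[R]_N) :=
  forall e, 0 < e -> exists2 d, 0 < d & forall q r, `|q - p| <= d -> `|r - p| <= d ->
    `|ev P q - ev P r - dotp (grad P p) (q - r)| <= e * `|q - r|.

Definition ev_cont N (P : {mpoly R[N]}) (p : 'rV[R]_N) :=
  forall e, 0 < e -> exists2 d, 0 < d & forall q, `|q - p| <= d -> `|ev P q - ev P p| <= e.

Lemma strict_diff_cont N (P : {mpoly R[N]}) p : strict_diff P p -> ev_cont P p.
Proof.
move=> SD e e0; have [d d0 H] := SD 1 ltr01.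
set C := \sum_j `|grad P p 0 j|; have C0 : 0 <= C by apply: sumr_ge0.
exists (Num.min d (e / (C + 1))) => [|q]; first by rewrite lt_min d0 divr_gt0 // ltr_wpDl.
rewrite le_min => /andP[qd qe].
have := H q p qd; rewrite subrr normr0 => /(_ (ltW d0)) H1.
have H2 := dotp_bound (grad P p) (q - p); rewrite -/C in H2.
rewrite ler_pdivlMr ?ltr_wpDl // in qe.
move: H1 H2 qe; set a := ev P q - ev P p; set b := dotp _ _; set n := `|q - p|.
move=> H1 H2 qe; apply: le_trans qe.
rewrite -[a](subrK b); apply: le_trans (ler_normD _ _) _; nra.
Qed.

Lemma mpoly_strict_diff N (P : {mpoly R[N]}) p : strict_diff P p.
Proof.
elim/mpoly_ring_ind: P => [c|i|P Q IHP IHQ|P Q IHP IHQ] e e0.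
- exists 1 => // q r _ _; rewrite /ev !mevalC subrr sub0r normrN /dotp big1 ?normr0 ?mulr_ge0 // ?ltW //.
  by move=> j _; rewrite mxE mderivC /ev meval0 mul0r.
- exists 1 => // q r _ _; rewrite /ev !mevalXU /dotp (bigD1 i) //= big1 ?addr0 => [|j ji].
    by rewrite mxE /ev mderiv_var eqxx meval1 mul1r !mxE subrr normr0 mulr_ge0 // ltW.
  by rewrite mxE /ev mderiv_var eq_sym (negPf ji) meval0 mul0r.
- have e20 : 0 < e / 2 by rewrite divr_gt0.
  have [d1 d10 H1] := IHP _ e20; have [d2 d20 H2] := IHQ _ e20.
  exists (Num.min d1 d2) => [|q r]; first by rewrite lt_min d10.
  rewrite !le_min => /andP[q1 q2] /andP[r1 r2].
  have -> : dotp (grad (P + Q) p) (q - r) = dotp (grad P p) (q - r) + dotp (grad Q p) (q - r).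
    rewrite -big_split; apply: eq_bigr => j _ /=.
    by rewrite !(mxE (matrix_key)) mderivD /ev mevalD mulrDl.
  rewrite /ev !mevalD -!/(ev _ _).
  have := H1 q r q1 r1; have := H2 q r q2 r2.
  set a := ev P q; set b := ev P r; set c := ev Q q; set d := ev Q r.
  set x := dotp _ _; set y := dotp _ _; set n := `|q - r| => K1 K2.
  have -> : a + c - (b + d) - (y + x) = (a - b - y) + (c - d - x) by lra.
  apply: le_trans (ler_normD _ _) _; lra.
have CP := strict_diff_cont IHP; have CQ := strict_diff_cont IHQ.
set A := `|ev P p| + 1; set B := `|ev Q p| + 1.
have A0 : 0 < A by rewrite /A ltr_wpDl.
have B0 : 0 < B by rewrite /B ltr_wpDl.
set C := \sum_j `|grad P p 0 j| + 1; set D := \sum_j `|grad Q p 0 j| + 1.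
have C0 : 0 < C by rewrite /C ltr_wpDl // sumr_ge0.
have D0 : 0 < D by rewrite /D ltr_wpDl // sumr_ge0.
have e4 (x : R) : 0 < x -> 0 < e / (4 * x) by move=> x0; rewrite divr_gt0 // mulr_gt0.
have [d1 d10 H1] := IHP _ (e4 _ B0); have [d2 d20 H2] := IHQ _ (e4 _ A0).
have [d3 d30 H3] := CP _ (e4 _ D0); have [d4 d40 H4] := CQ _ (e4 _ C0).
have [d5 d50 H5] := CP _ ltr01; have [d6 d60 H6] := CQ _ ltr01.
exists (Num.min d1 (Num.min d2 (Num.min d3 (Num.min d4 (Num.min d5 d6))))) => [|q r].
  by rewrite !lt_min d10 d20 d30 d40 d50 d60.
rewrite !le_min => /and5P[q1 q2 q3 q4 /andP[q5 q6]] /and5P[r1 r2 r3 r4 /andP[r5 r6]].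
have -> : dotp (grad (P * Q) p) (q - r) =
    ev Q p * dotp (grad P p) (q - r) + ev P p * dotp (grad Q p) (q - r).
  rewrite !mulr_sumr -big_split; apply: eq_bigr => j _ /=.
  rewrite ![grad _ _ _ _]mxE mderivM /ev mevalD !mevalM; ring.
rewrite /ev !mevalM -!/(ev _ _).
have := H1 q r q1 r1; have := H2 q r q2 r2; have := H3 q q3; have := H4 r r4.
have Pq : `|ev P q| <= A.
  rewrite -[ev P q](subrK (ev P p)) /A addrC; apply: le_trans (ler_normD _ _) _.
  by rewrite lerD2l H5.
have Qr : `|ev Q r| <= B.
  rewrite -[ev Q r](subrK (ev Q p)) /B addrC; apply: le_trans (ler_normD _ _) _.
  by rewrite lerD2l H6.
have dP : `|dotp (grad P p) (q - r)| <= C * `|q - r|.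
  by apply: le_trans (dotp_bound _ _) _; rewrite ler_wpM2r // /C lerDl.
have dQ : `|dotp (grad Q p) (q - r)| <= D * `|q - r|.
  by apply: le_trans (dotp_bound _ _) _; rewrite ler_wpM2r // /D lerDl.
move: Pq Qr dP dQ; set a := ev P q; set b := ev P r; set c := ev Q q; set d := ev Q r.
set x := dotp _ _; set y := dotp _ _; set n := `|q - r| => Pq Qr dP dQ K4 K3 K2 K1.
have -> : a * c - b * d - (ev Q p * x + ev P p * y) =
   a * (c - d - y) + d * (a - b - x) + ((a - ev P p) * y + (d - ev Q p) * x) by ring.
have n0 : 0 <= n by apply: normr_ge0.
have mulle (u v U V : R) : `|u| <= U -> `|v| <= V -> `|u * v| <= U * V.
  by move=> uU vV; rewrite normrM ler_pM.
have L1 := mulle _ _ _ _ Pq K2; have L2 := mulle _ _ _ _ Qr K1.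
have L3 := mulle _ _ _ _ K3 dQ; have L4 := mulle _ _ _ _ K4 dP.
have E1 (x1 : R) : 0 < x1 -> x1 * (e / (4 * x1) * n) = e * n / 4.
  by move=> x10; field; rewrite lt0r_neq0.
have E2 (x1 : R) : 0 < x1 -> e / (4 * x1) * (x1 * n) = e * n / 4.
  by move=> x10; field; rewrite lt0r_neq0.
rewrite E1 // in L1; rewrite E1 // in L2; rewrite E2 // in L3; rewrite E2 // in L4.
apply: le_trans (ler_normD _ _) _.
apply: le_trans (lerD (ler_normD _ _) (ler_normD _ _)) _.
lra.
Qed.

Lemma mpoly_cont N (P : {mpoly R[N]}) p : ev_cont P p.
Proof. exact/strict_diff_cont/mpoly_strict_diff. Qed.

(** The polynomial map from R^N to R^d with components F. *)
Definition evmap N d (F : 'I_d -> {mpoly R[N]}) (x : 'rV[R]_N) : 'rV[R]_d :=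
  \row_i ev (F i) x.

(** Its differential at p, acting on row vectors on the right: the transpose of
    the Jacobian matrix. *)
Definition dmap N d (F : 'I_d -> {mpoly R[N]}) (p : 'rV[R]_N) : 'M[R]_(N, d) :=
  \matrix_(j, i) ev (mderiv j (F i)) p.

Lemma fin_common_radius (I : finType) (Q : I -> R -> Prop) :
  (forall i d d', 0 < d' -> d' <= d -> Q i d -> Q i d') ->
  (forall i, exists2 d, 0 < d & Q i d) ->
  exists2 d, 0 < d & forall i, Q i d.
Proof.
move=> mono H; have /choice [f fP] : forall i, exists d, 0 < d /\ Q i d.
  by move=> i; have [d] := H i; exists d.
exists (\big[Num.min/1]_i f i).
  by apply/bigmin_gtP; split=> // i _; exact: (fP i).1.
move=> i; apply: mono (fP i).2; first by apply/bigmin_gtP; split=> // j _; exact: (fP j).1.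
exact: bigmin_le_cond.
Qed.

Lemma evmap_strict_diff N d (F : 'I_d -> {mpoly R[N]}) p e : 0 < e ->
  exists2 del, 0 < del & forall q r, `|q - p| <= del -> `|r - p| <= del ->
    `|evmap F q - evmap F r - (q - r) *m dmap F p| <= e * `|q - r|.
Proof.
move=> e0.
have [||del del0 H] := @fin_common_radius 'I_d (fun i del =>
  forall q r, `|q - p| <= del -> `|r - p| <= del ->
    `|ev (F i) q - ev (F i) r - dotp (grad (F i) p) (q - r)| <= e * `|q - r|).
- move=> i d1 d2 _ d21 H q r q2 r2; apply: H; exact: le_trans d21.
- by move=> i; apply: mpoly_strict_diff.
exists del => // q r qd rd; apply: norm_rV_le; first by rewrite mulr_ge0 // ltW.
move=> i; have := H i q r qd rd; rewrite !mxE; congr (`|_ - _| <= _).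
by rewrite /dotp; apply: eq_bigr => j _; rewrite !mxE mulrC.
Qed.

Lemma mulmx_bound m n (K : 'M[R]_(m, n)) : exists2 k, 0 < k & forall x : 'rV_m, `|x *m K| <= k * `|x|.
Proof.
exists (\sum_i \sum_j `|K i j| + 1); first by rewrite ltr_wpDl // sumr_ge0 // => i _; rewrite sumr_ge0.
move=> x; have S0 : 0 <= \sum_i \sum_j `|K i j| by rewrite sumr_ge0 // => i _; rewrite sumr_ge0.
apply: norm_rV_le; first by rewrite mulr_ge0 // addr_ge0.
move=> j; rewrite mxE; apply: le_trans (ler_norm_sum _ _ _) _.
apply: (@le_trans _ _ ((\sum_i \sum_j `|K i j|) * `|x|)); last by rewrite ler_wpM2r // lerDl.
rewrite mulr_suml; apply: ler_sum => i _; rewrite normrM mulrC ler_pM // ?coord_le_norm //.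
by rewrite (bigD1 j) //= lerDl sumr_ge0.
Qed.

Lemma evmap_lipschitz N d (F : 'I_d -> {mpoly R[N]}) p :
  exists del L, [/\ 0 < del, 0 < L & forall q r, `|q - p| <= del -> `|r - p| <= del ->
    `|evmap F q - evmap F r| <= L * `|q - r|].
Proof.
have [del del0 H] := evmap_strict_diff F p ltr01.
have [k k0 Hk] := mulmx_bound (dmap F p).
exists del, (k + 1); split=> // [|q r qd rd]; first by rewrite addr_gt0.
rewrite -[evmap F q - _](subrK ((q - r) *m dmap F p)).
apply: le_trans (ler_normD _ _) _; rewrite addrC mulrDl lerD //; exact: H.
Qed.

(** Where its differential has a right inverse, a polynomial map is injective
    with a Lipschitz inverse. *)
Lemma evmap_expansive N d (F : 'I_d -> {mpoly R[N]}) p (K : 'M_(d, N)) :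
  dmap F p *m K = 1%:M ->
  exists del L, [/\ 0 < del, 0 < L & forall q r, `|q - p| <= del -> `|r - p| <= del ->
    `|q - r| <= L * `|evmap F q - evmap F r|].
Proof.
move=> DK; have [k k0 Hk] := mulmx_bound K.
have e0 : 0 < 1 / (2 * k) by rewrite divr_gt0 // mulr_gt0.
have [del del0 H] := evmap_strict_diff F p e0.
exists del, (2 * k); split=> // [|q r qd rd]; first by rewrite mulr_gt0.
have E : q - r = (evmap F q - evmap F r) *m K -
    (evmap F q - evmap F r - (q - r) *m dmap F p) *m K.
  by rewrite (mulmxBl (evmap F q - evmap F r)) -(mulmxA (q - r)) DK mulmx1 opprB [RHS]addrC subrK.
have N1 := Hk (evmap F q - evmap F r).
have N2 := Hk (evmap F q - evmap F r - (q - r) *m dmap F p).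
have N3 := H q r qd rd.
have : `|q - r| <= `|(evmap F q - evmap F r) *m K| +
   `|(evmap F q - evmap F r - (q - r) *m dmap F p) *m K|.
  rewrite {1}E; exact: ler_normB.
have : k * `|evmap F q - evmap F r - (q - r) *m dmap F p| <= `|q - r| / 2.
  apply: (@le_trans _ _ (k * (1 / (2 * k) * `|q - r|))); first by rewrite ler_pM2l.
  by rewrite le_eqVlt; apply/orP; left; apply/eqP; field; rewrite lt0r_neq0.
move: N1 N2; set a := `|q - r|; set b := `|evmap F q - evmap F r|.
set c := `|_ *m K|; set d1 := `|_ *m K|; lra.
Qed.

(** Where its differential is invertible, a polynomial map is open: solve
    F x = y by the iteration x - (F x - y) F'(p)^-1, a contraction near p. *)
Lemma evmap_open N (F : 'I_N -> {mpoly R[N]}) p del0 : 0 < del0 ->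
  dmap F p \in unitmx ->
  exists2 rho, 0 < rho & forall y, `|y - evmap F p| <= rho ->
    exists2 x, `|x - p| <= del0 & evmap F x = y.
Proof.
move=> del00 Du; set K := invmx (dmap F p).
have DK : dmap F p *m K = 1%:M by rewrite mulmxV.
have [k k0 Hk] := mulmx_bound K.
have e0 : 0 < 1 / (2 * k) by rewrite divr_gt0 // mulr_gt0.
have [del1 del10 H] := evmap_strict_diff F p e0.
set del := Num.min del0 del1.
have dp : 0 < del by rewrite lt_min del00.
exists (del / (2 * k)); first by rewrite divr_gt0 // mulr_gt0.
move=> y yF; pose f x := x - (evmap F x - y) *m K.
have fdiff q r : `|q - p| <= del -> `|r - p| <= del -> `|f q - f r| <= 2^-1 * `|q - r|.
  rewrite !le_min => /andP[_ qd] /andP[_ rd].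
  have -> : f q - f r = - ((evmap F q - evmap F r - (q - r) *m dmap F p) *m K).
    rewrite /f (mulmxBl (evmap F q - evmap F r)) -(mulmxA (q - r)) DK mulmx1 opprB.
    rewrite !mulmxBl opprB; apply/matrixP => a b; rewrite !mxE; ring.
  rewrite normrN; apply: le_trans (Hk _) _.
  apply: (@le_trans _ _ (k * (1 / (2 * k) * `|q - r|))); first by rewrite ler_pM2l // H.
  by rewrite le_eqVlt; apply/orP; left; apply/eqP; field; rewrite lt0r_neq0.
pose U : set 'rV[R]_N := closed_ball p del.
have UE x : U x <-> `|x - p| <= del.
  by rewrite /U closed_ballE // /closed_ball_ /= distrC.
have fU : {homo f : x / U x >-> U x}.
  move=> x /UE xU; apply/UE.
  rewrite -(subrK (f p) (f x)) -addrA; apply: le_trans (ler_normD _ _) _.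
  have pd : `|p - p| <= del by rewrite subrr normr0 ltW.
  have := fdiff x p xU pd.
  have : `|f p - p| <= del / 2.
    rewrite /f addrAC subrr add0r normrN; apply: le_trans (Hk _) _.
    rewrite distrC; apply: (@le_trans _ _ (k * (del / (2 * k)))); first by rewrite ler_pM2l.
    by rewrite le_eqVlt; apply/orP; left; apply/eqP; field; rewrite lt0r_neq0.
  set a := `|f p - p|; set b := `|f x - f p|; set c := `|x - p| in xU *; lra.
have h0 : (0 : R) <= 2^-1 by rewrite invr_ge0.
have ctr : is_contraction [fun of mkfun fU].
  exists ((2^-1)%:nng); split=> /=; first by rewrite invf_lt1 // ltr1n.
  move=> [q r] [/= /UE qU /UE rU]; exact: fdiff.
have [||x xU xE] := banach_fixed_point ctr.
- exact: closed_ball_closed.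
- by exists p; apply/UE; rewrite subrr normr0 ltW.
exists x; first by move/UE: xU; rewrite le_min => /andP[].
have /eqP : (evmap F x - y) *m K = 0.
  have /eqP := xE; rewrite /= /mkfun /f eq_sym -subr_eq0 addrAC subrr add0r oppr_eq0.
  by move=> /eqP.
have Ku : K \in unitmx by rewrite unitmx_inv.
rewrite mulmx_free_eq0 ?row_free_unit // subr_eq0 => /eqP //.
Qed.

End Analysis.

(** * Null sets and Lipschitz maps *)

Section NullSets.
Variable R : realType.

(** S is covered by countably many closed cubes of total volume at most e.  The
    predicate D selects the indices in use; it allows empty covers although all
    radii are positive. *)
Definition cubecov N (S : set 'rV[R]_N) (e : R) :=
  exists (D : pred nat) (x : nat -> 'rV[R]_N) (r : nat -> R),
  [/\ forall k, 0 < r k,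
      forall y, S y -> exists2 k, D k & `|y - x k| <= r k
    & forall s, uniq s -> \sum_(k <- s | D k) (2 * r k) ^+ N <= e].

(** Null sets for the Lebesgue measure of R^N, defined with cubes rather than
    boxes since Lipschitz maps send cubes into cubes of comparable volume. *)
Definition null N (S : set 'rV[R]_N) := forall e, 0 < e -> cubecov S e.

Lemma cubecov_count N (S : set 'rV[R]_N) (e : R) (I : countType)
  (D : pred I) (x : I -> 'rV[R]_N) (r : I -> R) :
  (forall k, 0 < r k) ->
  (forall y, S y -> exists2 k, D k & `|y - x k| <= r k) ->
  (forall s, uniq s -> \sum_(k <- s | D k) (2 * r k) ^+ N <= e) ->
  cubecov S e.
Proof.
move=> r0 SD De.
exists (fun n => oapp D false (pickle_inv n)), (fun n => oapp x 0 (pickle_inv n)),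
   (fun n => oapp r 1 (pickle_inv n)); split.
- by move=> k; case: pickle_inv => //=.
- by move=> y /SD [k Dk yk]; exists (pickle k); rewrite pickleK_inv.
move=> s us; have us' := pmap_uniq (@pickle_invK I) us.
apply: le_trans (De _ us'); rewrite big_mkcond [leRHS]big_mkcond big_pmap.
by apply: ler_sum => k _; case: pickle_inv.
Qed.

Lemma sum_pairs_le (I J : eqType) (P : pred I) (Q : I -> pred J) (v : I -> J -> R)
  (e : I -> R) (s : seq (I * J)) : uniq s ->
  (forall i t, P i -> uniq t -> \sum_(j <- t | Q i j) v i j <= e i) ->
  \sum_(p <- s | P p.1 && Q p.1 p.2) v p.1 p.2 <=
    \sum_(i <- undup (map fst s) | P i) e i.
Proof.
move=> us H; set U := undup _.
have -> : \sum_(p <- s | P p.1 && Q p.1 p.2) v p.1 p.2 =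
   \sum_(i <- U | P i) \sum_(p <- s | Q p.1 p.2 && (p.1 == i)) v p.1 p.2.
  rewrite (exchange_big_dep (fun p => P p.1 && Q p.1 p.2)) /=; last first.
    by move=> i p Pi /andP[Qp /eqP pi]; rewrite pi Pi -pi Qp.
  rewrite big_seq_cond [RHS]big_seq_cond; apply: eq_bigr => p /and3P[ps Pp Qp].
  rewrite (eq_bigl (fun i => i == p.1)); first last.
    by move=> i; rewrite Qp /= eq_sym; case: eqP => [->|]; rewrite ?Pp // andbF.
  by rewrite -big_filter filter_pred1_uniq ?undup_uniq ?mem_undup ?map_f // big_seq1.
apply: ler_sum => i Pi; set t := [seq p.2 | p <- s & p.1 == i].
apply: le_trans (H i t Pi _).
  rewrite /t big_map big_filter_cond.
  rewrite le_eqVlt; apply/orP; left; apply/eqP; apply: eq_big => p.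
    by rewrite andbC; case: eqP => [->|].
  by move=> /andP[_ /eqP ->].
rewrite map_inj_in_uniq ?filter_uniq // => -[a b] [c d].
by rewrite !mem_filter /= => /andP[/eqP -> _] /andP[/eqP -> _] ->.
Qed.

(** Countable subadditivity of the outer measure. *)
Lemma cubecov_bigcup N (I : countType) (D : pred I) (T : I -> set 'rV[R]_N)
    (e : I -> R) (S : set 'rV[R]_N) (E : R) :
  (forall y, S y -> exists2 k, D k & T k y) ->
  (forall k, D k -> cubecov (T k) (e k)) ->
  (forall s, uniq s -> \sum_(k <- s | D k) e k <= E) -> cubecov S E.
Proof.
move=> ST Tc eE.
have /choice [D' /choice [x /choice [r H]]] : forall k, exists (D' : pred nat) (x : nat -> 'rV[R]_N) (r : nat -> R), D k ->
  [/\ forall j, 0 < r j,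
      forall y, T k y -> exists2 j, D' j & `|y - x j| <= r j
    & forall s, uniq s -> \sum_(j <- s | D' j) (2 * r j) ^+ N <= e k].
  move=> k; have [Dk|nD] := boolP (D k); last by exists xpred0, (fun=> 0), (fun=> 1).
  by have [D' [x [r [? ? ?]]]] := Tc k Dk; exists D', x, r.
apply: (@cubecov_count N S E (I * nat)%type (fun p => D p.1 && D' p.1 p.2)
   (fun p => x p.1 p.2) (fun p => if D p.1 then r p.1 p.2 else 1)).
- by move=> [k j] /=; have [/H [-> //]|//] := boolP (D k).
- move=> y /ST [k Dk /=]; have [_ Tk _ /Tk [j Dj yj]] := H k Dk.
  by exists (k, j) => /=; rewrite Dk.
move=> s us; apply: le_trans (eE _ (undup_uniq (map fst s))).
rewrite (eq_bigr (fun p => (2 * r p.1 p.2) ^+ N)); last by move=> p /andP[->].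
apply: (sum_pairs_le (v := fun i j => (2 * r i j) ^+ N)) => // i t Di ut.
by have [_ _] := H i Di; apply.
Qed.

Lemma cubecov_sub N (S T : set 'rV[R]_N) e : (forall y, S y -> T y) -> cubecov T e -> cubecov S e.
Proof. by move=> ST [D [x [r [r0 H He]]]]; exists D, x, r; split=> // y /ST/H. Qed.

Lemma null_sub N (S T : set 'rV[R]_N) : (forall y, S y -> T y) -> null T -> null S.
Proof. by move=> ST nT e /nT; exact: cubecov_sub. Qed.

Lemma sum_uniq_sub (I : eqType) (l m : seq I) (P : pred I) (v : I -> R) :
  uniq l -> uniq m -> {subset l <= m} -> (forall i, 0 <= v i) ->
  \sum_(i <- l | P i) v i <= \sum_(i <- m | P i) v i.
Proof.
move=> ul um lm v0; have pe : perm_eq l [seq k <- m | k \in l].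
  by apply: uniq_perm; rewrite ?filter_uniq // => k; rewrite mem_filter andb_idr // => /lm.
rewrite (perm_big _ pe) /=.
rewrite big_filter_cond big_mkcond [leRHS]big_mkcond.
by apply: ler_sum => k _; case: (P k); rewrite ?andbF // andbT; case: ifP.
Qed.

Lemma sum_geometric_half_le (s : seq nat) : uniq s -> \sum_(k <- s) (2^-1) ^+ k.+1 <= 1 :> R.
Proof.
move=> us; pose m := (\max_(k <- s) k).+1%N.
have geo : \sum_(k < m) (2^-1 : R) ^+ k.+1 = 1 - 2^-1 ^+ m.
  elim: m => [|m IH]; first by rewrite big_ord0 expr0 subrr.
  by rewrite big_ord_recr /= IH !exprS; field.
apply: (@le_trans _ _ (\sum_(k < m) (2^-1 : R) ^+ k.+1)); last first.
  by rewrite geo lerBlDr lerDl exprn_ge0 // invr_ge0.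
rewrite -(big_mkord xpredT (fun k => (2^-1 : R) ^+ k.+1)).
apply: sum_uniq_sub => [||k ks|k]; rewrite ?iota_uniq ?exprn_ge0 ?invr_ge0 //.
by rewrite mem_index_iota /= ltnS /m; exact: leq_bigmax_seq.
Qed.

Lemma null_bigcup N (I : countType) (T : I -> set 'rV[R]_N) (S : set 'rV[R]_N) :
  (forall y, S y -> exists k, T k y) -> (forall k, null (T k)) -> null S.
Proof.
move=> ST nT e e0.
apply: (@cubecov_bigcup N I xpredT T (fun k => e * (2^-1) ^+ (pickle k).+1)).
- by move=> y /ST [k Tk]; exists k.
- by move=> k _; apply: nT; rewrite mulr_gt0 // exprn_gt0 // invr_gt0.
move=> s us; rewrite -mulr_sumr ler_piMr ?(ltW e0) //.
have := @sum_geometric_half_le (map pickle s); rewrite big_map; apply.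
by rewrite map_inj_uniq //; exact: (pcan_inj pickleK).
Qed.

Lemma null_setU N (A B S : set 'rV[R]_N) :
  (forall y, S y -> A y \/ B y) -> null A -> null B -> null S.
Proof.
move=> SAB nA nB; apply: (@null_bigcup _ bool (fun b => if b then A else B)).
  by move=> y /SAB [Ay|By]; [exists true|exists false].
by case.
Qed.

(** A set in Lipschitz correspondence with a null set is null.  With a relation
    rl, the lemma applies both to the images of Lipschitz maps and to the
    preimages of maps with a Lipschitz inverse. *)
Lemma null_lipschitz N (T S : set 'rV[R]_N) (rl : 'rV[R]_N -> 'rV[R]_N -> Prop) L :
  0 < L -> null T ->
  (forall q, S q -> exists2 y, T y & rl q y) ->
  (forall q r y z, S q -> S r -> rl q y -> rl r z -> `|q - r| <= L * `|y - z|) ->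
  null S.
Proof.
move=> L0 nT ST HL e e0.
have L20 : 0 < (2 * L) ^+ N by rewrite exprn_gt0 // mulr_gt0.
have [|D [x [r [r0 TD De]]]] := nT (e / (2 * L) ^+ N); first by rewrite divr_gt0.
pose hit k q := S q /\ exists2 y, `|y - x k| <= r k & rl q y.
have /choice [q0 Hq0] : forall k, exists q0, (exists q, hit k q) -> hit k q0.
  move=> k; have [[q hq]|n] := pselect (exists q, hit k q); first by exists q.
  by exists 0.
exists (fun k => D k && `[< exists q, hit k q >]), q0, (fun k => 2 * L * r k); split.
- by move=> k; rewrite !mulr_gt0.
- move=> q Sq; have [y Ty qy] := ST q Sq; have [k Dk yk] := TD y Ty.
  have hk : exists q, hit k q by exists q; split=> //; exists y.
  exists k; first by rewrite Dk; apply/asboolP.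
  have [Sq0 [y0 y0k q0y0]] := Hq0 k hk.
  apply: le_trans (HL _ _ _ _ Sq Sq0 qy q0y0) _.
  rewrite -mulrA mulrCA ler_pM2l // -[y](subrK (x k)) -addrA.
  apply: le_trans (ler_normD _ _) _; rewrite mulr_natl mulr2n lerD //.
  by rewrite distrC.
move=> s us; have := De s us; rewrite ler_pdivlMr // => H; apply: le_trans H.
rewrite mulr_suml big_mkcond [leRHS]big_mkcond; apply: ler_sum => k _.
case: (D k) => //=; case: ifP => _.
  by rewrite -exprMn [2 * r k * _]mulrC [2 * (2 * _ * _)]mulrCA.
by rewrite mulr_ge0 ?exprn_ge0 ?mulr_ge0 // ltW.
Qed.

Lemma prod_shift_le n (s : 'I_n -> R) t : (forall i, 0 <= s i) -> 0 <= t -> t <= 1 ->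
  \prod_i (s i + t) <= \prod_i s i + t * \prod_i (s i + 2).
Proof.
move=> s0 t0 t1.
suff [] : [/\ 0 <= \prod_i s i, \prod_i s i <= \prod_i (s i + 2), 0 <= \prod_i (s i + t)
   & \prod_i (s i + t) <= \prod_i s i + t * \prod_i (s i + 2)] by [].
elim/big_rec3: _ => [|i S Q P _ [P0 PQ S0 SH]]; first by split => //; lra.
have si := s0 i; split; [exact: mulr_ge0|apply: ler_pM => //; lra|apply: mulr_ge0 => //; lra|].
apply: (@le_trans _ _ ((s i + t) * (P + t * Q))); first by apply: ler_wpM2l => //; lra.
have h1 : 0 <= t * (Q - P) by rewrite mulr_ge0 // subr_ge0.
have h2 : 0 <= t * (1 - t) * Q by rewrite mulr_ge0 ?mulr_ge0 ?subr_ge0 // (le_trans P0).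
nra.
Qed.

(** The cubes of side t which meet a box of sides s i number at most
    the product of the s i / t + 1; their total volume, at most the product of
    the s i + t, tends to that of the box. *)
Lemma box_cubecov N (a b : 'rV[R]_N) eta : (forall i, a 0 i <= b 0 i) -> 0 < eta ->
  cubecov [set x | forall i, a 0 i <= x 0 i <= b 0 i]%classic
    (\prod_i (b 0 i - a 0 i) + eta).
Proof.
move=> ab eta0; pose s i := b 0 i - a 0 i.
have s0 i : 0 <= s i by rewrite subr_ge0.
set Q := \prod_i (s i + 2).
have Q0 : 0 < Q by apply: prodr_gt0 => i _; rewrite ltr_wpDl.
pose t := Num.min 1 (eta / Q).
have t0 : 0 < t by rewrite lt_min ltr01 divr_gt0.
have t1 : t <= 1 by rewrite ge_min lexx.
have tQ : t * Q <= eta by rewrite -ler_pdivlMr // ge_min lexx orbT.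
pose K := (\max_i Num.truncn (s i / t)).+1%N.
have KP i : (Num.truncn (s i / t)%R < K)%N by rewrite ltnS (leq_bigmax i).
pose F i := [pred m : 'I_K | (m <= Num.truncn (s i / t)%R)%N].
apply: (@cubecov_count N _ _ {ffun 'I_N -> 'I_K} (mem (family F))
  (fun m => \row_i (a 0 i + (m i)%:R * t + t / 2)) (fun=> t / 2)).
- by move=> _; rewrite divr_gt0.
- move=> x xab.
  have xs i : 0 <= (x 0 i - a 0 i) / t /\ (x 0 i - a 0 i) / t <= s i / t.
    have /andP[x1 x2] := xab i; rewrite divr_ge0 ?subr_ge0 ?(ltW t0) // ler_pM2r ?invr_gt0 //.
    by rewrite lerD2r.
  have mK i : (Num.truncn ((x 0 i - a 0 i) / t)%R < K)%N.
    by apply: leq_ltn_trans (KP i); apply: Num.Theory.le_truncn; exact: (xs i).2.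
  exists [ffun i => Ordinal (mK i)].
    apply/familyP => i; rewrite ffunE inE /=.
    by apply: Num.Theory.le_truncn; exact: (xs i).2.
  apply: norm_rV_le; first by rewrite divr_ge0 // ltW.
  move=> i; rewrite !mxE ffunE /=.
  have /andP[] := Num.Theory.truncn_itv (xs i).1.
  rewrite ler_pdivlMr // ltr_pdivrMr // -natr1.
  set m := _%:R; move=> h1 h2; rewrite ler_norml; apply/andP; split; lra.
move=> l ul; have -> : 2 * (t / 2) = t by field.
apply: (@le_trans _ _ (\sum_(m in family F) t ^+ N)).
  apply: sum_uniq_sub => [||m _|m]; rewrite ?index_enum_uniq ?mem_index_enum //.
  by rewrite exprn_ge0 // ltW.
rewrite sumr_const card_family foldrE big_map big_enum /=.
apply: (@le_trans _ _ (\prod_i (s i + t))); last first.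
  apply: le_trans (prod_shift_le s0 (ltW t0) t1) _.
  by rewrite lerD2l.
rewrite -mulr_natl natr_prod -[N in t ^+ N]card_ord -prodr_const -big_split /=.
apply: ler_prod => i _; rewrite mulr_ge0 ?ler0n ?(ltW t0) //=.
have E : (s i + t) / t = s i / t + 1 by rewrite mulrDl mulfV ?lt0r_neq0.
rewrite -ler_pdivlMr // E.
apply: (@le_trans _ _ ((Num.truncn (s i / t)).+1%:R)).
  rewrite ler_nat cardE -(size_map val) -(size_iota 0 (_.+1)).
  apply: uniq_leq_size => [|k /mapP [m]].
    by rewrite map_inj_uniq ?enum_uniq //; exact: val_inj.
  by rewrite mem_enum => mT ->; rewrite mem_iota /= add0n ltnS.
by rewrite -natr1 lerD2r Num.Theory.truncn_le divr_ge0 // ltW.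
Qed.

End NullSets.

(** * Cubes are not null, zero sets are *)

Section CubesAndZeroSets.
Variable R : realType.

Lemma measure_zero_null N (S : set 'rV[R]_N) : measure_zero S -> null S.
Proof.
move=> mS e e0; have e20 : 0 < e / 2 by rewrite divr_gt0.
have [D [a [b [ab SD vol]]]] := mS _ e20.
have v0 k : 0 <= \prod_i (b k 0 i - a k 0 i).
  by apply: prodr_ge0 => i _; rewrite subr_ge0.
apply: (@cubecov_bigcup R N nat D
   (fun k => [set x | forall i, a k 0 i <= x 0 i <= b k 0 i]%classic)
   (fun k => \prod_i (b k 0 i - a k 0 i) + e / 2 * 2^-1 ^+ k.+1)).
- by move=> y /SD.
- move=> k _; apply: box_cubecov; first exact: ab.
  by rewrite mulr_gt0 // exprn_gt0 // invr_gt0.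
move=> s us; rewrite big_split /= [e in _ <= e]splitr lerD //.
  pose m := (\max_(k <- s) k).+1%N.
  apply: le_trans (vol m); rewrite -(big_mkord D (fun k => \prod_i (b k 0 i - a k 0 i))).
  apply: sum_uniq_sub => [||k ks|k]; rewrite ?iota_uniq //.
  by rewrite mem_index_iota /= ltnS /m; exact: leq_bigmax_seq.
rewrite -mulr_sumr ler_piMr ?(ltW e20) //.
apply: le_trans (@sum_geometric_half_le R s us); rewrite big_mkcond; apply: ler_sum => k _.
by case: ifP => // _; rewrite exprn_ge0 // invr_ge0.
Qed.

Lemma null_measure_zero N (S : set 'rV[R]_N) : null S -> measure_zero S.
Proof.
move=> nS e e0; have [D [x [r [r0 SD De]]]] := nS _ e0.
exists D, (fun k => \row_i (x k 0 i - r k)), (fun k => \row_i (x k 0 i + r k)); split.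
- by move=> k i; rewrite !mxE; have := r0 k; lra.
- move=> y /SD [k Dk yk]; exists k => // i; rewrite !mxE.
  have := coord_le_norm (y - x k) i; rewrite !mxE => /le_trans /(_ yk).
  by rewrite ler_norml => /andP[]; lra.
move=> m; rewrite (eq_bigr (fun k : 'I_m => (2 * r k) ^+ N)); last first.
  move=> k _; rewrite -[N in RHS]card_ord -prodr_const; apply: eq_bigr => i _.
  by rewrite !mxE; ring.
rewrite -(big_mkord D (fun k => (2 * r k) ^+ N)).
exact: De (iota_uniq _ _).
Qed.

(** An interval of length 2 r contains at most 2 r M + 1 points of the grid of
    mesh 1 / M. *)
Lemma card_grid_le (M : nat) (x r : R) : (0 < M)%N -> 0 <= r ->
  (#|[pred g : 'I_M | `|(g : nat)%:R / M%:R - x| <= r]|)%:R <= 2 * r * M%:R + 1 :> R.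
Proof.
move=> M0 r0; set A := [pred g | _]; have M0' : 0 < M%:R :> R by rewrite ltr0n.
have rM : 0 <= 2 * r * M%:R by rewrite !mulr_ge0 // ler0n.
have [g0 Ag0|A0] := pickP A; last by rewrite eq_card0 // addr_ge0.
case: (arg_minnP (fun g : 'I_M => g : nat) Ag0) => m Am minm.
set T := Num.truncn (2 * r * M%:R).
apply: (@le_trans _ _ (T.+1%:R)); last by rewrite -natr1 lerD2r Num.Theory.truncn_le.
rewrite ler_nat cardE -(size_map val) -(size_iota m T.+1).
apply: uniq_leq_size => [|k /mapP [g]].
  by rewrite map_inj_uniq ?enum_uniq //; exact: val_inj.
rewrite mem_enum => Ag ->; rewrite mem_iota minm //= addnS ltnS -leq_subLR.
rewrite -[leqLHS](@Num.Theory.natrK R); apply: Num.Theory.le_truncn.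
rewrite natrB ?minm //.
have := Am; have := Ag; rewrite !inE !ler_norml => /andP[_ h1] /andP[h2 _].
rewrite -ler_pdivrMr // mulrBl; lra.
Qed.

(** By compactness, a cover may be assumed finite and open at the cost of
    doubling the radii.  Counting the points of a fine grid then bounds its
    volume below by 4 ^- N. *)
Lemma unit_cube_not_null N : ~ null [set x : 'rV[R]_N | forall i, 0 <= x 0 i <= 1]%classic.
Proof.
move=> nC; set C := (X in null X) in nC.
have e0 : 0 < (2 * 4 ^+ N)^-1 :> R by rewrite invr_gt0 mulr_gt0 // exprn_gt0.
have [D [x [r [r0 CD De]]]] := nC _ e0.
have Ccpt : compact C.
  apply: (@rV_compact R N (fun=> [set t : R | 0 <= t <= 1]%classic)) => i.
  by rewrite -set_itvcc; exact: segment_compact.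
move: Ccpt; rewrite compact_cover => /(_ nat [set k | D k]%classic (fun k => ball (x k) (2 * r k))).
case=> [k _||D' D'D Ccov]; first exact: ball_open.
  move=> y /CD [k Dk yk]; exists k => //; rewrite -ball_normE /= distrC.
  by apply: le_lt_trans yk _; rewrite ltr_pMl ?r0 // ltr1n.
pose s := finmap.enum_fset D'.
have us : uniq s by exact: finmap.fset_uniq.
have Ds k : k \in s -> D k by move=> /D'D; rewrite inE.
(* For this M, a cube of radius 2 r k has at most (8 r k M) ^ N grid points. *)
pose M := (\max_(k <- s) (Num.truncn (4 * r k)^-1).+1).+1%N.
have M0 : 0 < M%:R :> R by rewrite ltr0n.
have MP k : k \in s -> 1 <= 4 * r k * M%:R.
  move=> ks; rewrite mulrC -ler_pdivrMr ?mulr_gt0 // mul1r.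
  have k0 : 0 <= (4 * r k)^-1 by rewrite invr_ge0 mulr_ge0 // ltW.
  have /andP[_ /ltW h] := Num.Theory.truncn_itv k0; apply: le_trans h _.
  by rewrite ler_nat /M (big_rem k) //= leqW // leq_max leqnn.
pose pt (g : {ffun 'I_N -> 'I_M}) : 'rV[R]_N := \row_i ((g i)%:R / M%:R).
have ptC g : C (pt g).
  move=> i; rewrite mxE divr_ge0 ?ler0n //= ler_pdivrMr // mul1r ler_nat.
  exact: ltnW.
pose B k (i : 'I_N) := [pred g : 'I_M | `|(g : nat)%:R / M%:R - x k 0 i| <= 2 * r k].
have cnt : (M ^ N <= \sum_(k <- s) #|family (B k)|)%N.
  rewrite -[M in leqLHS]card_ord -[N in leqLHS]card_ord -card_ffun.
  rewrite -sum1_card; apply: (@leq_trans (\sum_(g in {: {ffun 'I_N -> 'I_M}}) \sum_(k <- s) (g \in family (B k)))).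
    apply: leq_sum => g _; have [k /= ks] := Ccov _ (ptC g).
    rewrite -ball_normE /= distrC => gk.
    have kin : k \in s by [].
    rewrite (big_rem k) //=; apply: leq_trans (leq_addr _ _).
    rewrite lt0b; apply/familyP => i; rewrite inE.
    by have := coord_le_norm (pt g - x k) i; rewrite !mxE => /le_trans; apply; exact: ltW.
  rewrite exchange_big /=; apply: leq_sum => k _.
  rewrite -[leqRHS]sum1_card big_mkcond [leqRHS]big_mkcond /=.
  by apply: leq_sum => g _; case: (g \in family _) => //; case: ifP.
have cntR : (M%:R : R) ^+ N <= \sum_(k <- s) (8 * r k * M%:R) ^+ N.
  rewrite -natrX; apply: (@le_trans _ _ ((\sum_(k <- s) #|family (B k)|)%N%:R)); first by rewrite ler_nat.
  rewrite natr_sum big_seq [leRHS]big_seq; apply: ler_sum => k ks.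
  rewrite card_family foldrE big_map big_enum /= natr_prod.
  rewrite -[N in leRHS]card_ord -prodr_const; apply: ler_prod => i _.
  rewrite ler0n /=; have r2 : 0 <= 2 * r k by rewrite mulr_ge0 // ltW.
  apply: le_trans (card_grid_le (x k 0 i) _ r2) _; first by [].
  have := MP k ks; lra.
have : (M%:R : R) ^+ N <= M%:R ^+ N / 2.
  apply: le_trans cntR _.
  have -> : \sum_(k <- s) (8 * r k * M%:R) ^+ N = (4 ^+ N * \sum_(k <- s | D k) (2 * r k) ^+ N) * M%:R ^+ N.
    rewrite mulr_sumr mulr_suml big_seq [RHS]big_seq_cond.
    apply: eq_big => k; first by case: (boolP (k \in s)) => //= /Ds ->.
    by move=> _; rewrite -!exprMn; congr (_ ^+ _); ring.
  rewrite [leLHS]mulrC; apply: ler_wpM2l; first by rewrite exprn_ge0 // ltW.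
  have four0 : 0 < 4 ^+ N :> R by rewrite exprn_gt0.
  apply: (@le_trans _ _ (4 ^+ N * (2 * 4 ^+ N)^-1)); first by rewrite ler_pM2l // De.
  by rewrite invfM mulrCA mulfV ?mulr1 // lt0r_neq0.
have : 0 < (M%:R : R) ^+ N by rewrite exprn_gt0.
lra.
Qed.

Lemma cube_not_null N (p : 'rV[R]_N) rho : 0 < rho ->
  ~ null [set x | `|x - p| <= rho]%classic.
Proof.
move=> rho0 nC; apply: (@unit_cube_not_null N).
have h0 : 0 < rho^-1 by rewrite invr_gt0.
apply: (null_lipschitz (rl := fun q y => y = p + rho *: q) h0 nC).
  move=> q qC; exists (p + rho *: q) => //=; rewrite addrAC subrr add0r normrZ gtr0_norm //.
  rewrite ler_piMr ?(ltW rho0) //; apply: norm_rV_le => // i.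
  by have /andP[h1 h2] := qC i; rewrite ger0_norm.
move=> q r y z _ _ -> ->; rewrite opprD addrACA subrr add0r -scalerBr normrZ gtr0_norm //.
by rewrite mulrA mulVf ?mul1r // lt0r_neq0.
Qed.

(** Countably many cubes with rational centres suffice to cover S. *)
Lemma null_local N (S : set 'rV[R]_N) :
  (forall p, S p -> exists2 d, 0 < d & null [set x | S x /\ `|x - p| <= d]%classic) -> null S.
Proof.
move=> loc.
pose c (q : {ffun 'I_N -> rat}) : 'rV[R]_N := \row_i ratr (q i).
pose T (k : {ffun 'I_N -> rat} * nat) := [set x | S x /\ `|x - c k.1| <= k.2.+1%:R^-1]%classic.
pose T' k := if `[< null (T k) >] then T k else set0.
apply: (@null_bigcup _ _ _ T'); last first.
  move=> k; rewrite /T'; case: asboolP => // _ e e0.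
  exists xpred0, (fun=> 0), (fun=> 1); split=> // s _; rewrite big_pred0 // ltW //.
move=> p Sp; have [d d0 nd] := loc p Sp.
pose m := Num.truncn (2 / d); have d20 : 0 <= 2 / d by rewrite divr_ge0 // ltW.
have m0 : 0 < m.+1%:R^-1 :> R by rewrite invr_gt0 ltr0n.
have md : 2 * m.+1%:R^-1 <= d.
  have /andP[_ /ltW] := Num.Theory.truncn_itv d20; rewrite -/m ler_pdivrMr // => h.
  by rewrite ler_pdivrMr ?ltr0n // mulrC.
have /choice [q qP] : forall i, exists q : rat, `|p 0 i - ratr q| <= m.+1%:R^-1.
  move: m0; set w := m.+1%:R^-1 => m0 i.
  have : p 0 i - w < p 0 i + w by lra.
  move=> /rat_in_itvoo [q]; rewrite in_itv /= => /andP[h1 h2]; exists q.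
  by rewrite ler_norml; apply/andP; split; lra.
have pq : `|p - c (finfun q)| <= m.+1%:R^-1.
  by apply: norm_rV_le; [exact: ltW|move=> i; rewrite !mxE ffunE].
exists (finfun q, m); rewrite /T'; case: asboolP => [_|]; first by split.
case; apply: null_sub nd => y [Sy yq] /=; split=> //.
rewrite -(subrK (c (finfun q)) y) -addrA; apply: le_trans (ler_normD _ _) _.
apply: le_trans md; rewrite mulr_natl mulr2n; apply: lerD => //.
by rewrite distrC.
Qed.

Lemma hyperplane_null N (i : 'I_N) : null [set x : 'rV[R]_N | x 0 i = 0]%classic.
Proof.
pose b (k : nat) : 'rV[R]_N := \row_j (if j == i then 0 else k%:R).
apply: (@null_bigcup _ _ nat (fun k => [set x | forall j, (- b k) 0 j <= x 0 j <= b k 0 j]%classic)).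
  move=> x xi; exists (Num.truncn `|x|).+1 => j; rewrite !mxE.
  case: eqVneq => [->|_]; first by rewrite xi oppr0 lexx.
  rewrite -ler_norml; apply: le_trans (coord_le_norm x j) _.
  by have /andP[_ /ltW] := Num.Theory.truncn_itv (normr_ge0 x).
move=> k e e0; have := @box_cubecov R N (- b k) (b k) e; rewrite (bigD1 i) //=.
rewrite !mxE eqxx oppr0 subrr mul0r add0r; apply => // j; rewrite !mxE.
by case: eqP => _; [rewrite oppr0|rewrite ge0_cp // ler0n].
Qed.

(** Where a partial derivative of P does not vanish, replacing the i-th coordinate
    by P is a local bi-Lipschitz map which sends the zero set into a
    hyperplane; the zeros of the derivative are dealt with by induction. *)
Lemma mpoly_zero_null N (P : {mpoly R[N]}) : P != 0 -> null [set x | ev P x = 0]%classic.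
Proof.
have [k] := ubnP (msize P); elim: k P => // k IH P szP P0.
have [[i Di]|D0] := pselect (exists i, mderiv i P != 0); last first.
  apply: (@null_sub _ _ _ set0) => [x /=|e e0]; last first.
    by exists xpred0, (fun=> 0), (fun=> 1); split=> // s _; rewrite big_pred0 // ltW.
  have DD i : mderiv i P = 0 by apply/eqP; apply: contrapT => H; apply: D0; exists i; apply/negP.
  rewrite (mderiv_all0 DD) /ev mevalC => c0; case/eqP: P0.
  by rewrite (mderiv_all0 DD) c0 mpolyC0.
have szD : (msize (mderiv i P) < k)%N by apply: leq_trans (mderiv_lt i P0) _.
apply: (null_setU (A := [set x | ev (mderiv i P) x = 0]%classic)
  (B := [set x | ev P x = 0 /\ ev (mderiv i P) x <> 0]%classic)).
- by move=> x Px; have [|] := pselect (ev (mderiv i P) x = 0); [left|right].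
- exact: IH.
apply: null_local => p [Pp Dp].
pose F (j : 'I_N) := if j == i then P else 'X_j.
have Du : dmap F p \in unitmx.
  rewrite -row_free_unit; apply: inj_row_free => v vD.
  have vE j : (v *m dmap F p) 0 j = \sum_l v 0 l * ev (mderiv l (F j)) p.
    by rewrite mxE; apply: eq_bigr => l _; rewrite mxE.
  have vj j : j != i -> v 0 j = 0.
    move=> ji; have := vE j; rewrite vD mxE /F (negPf ji) (bigD1 j) //= big1 => [|l lj].
      by rewrite mderiv_var eqxx /ev meval1 mulr1 addr0.
    by rewrite mderiv_var eq_sym (negPf lj) /ev meval0 mulr0.
  apply/rowP => j; rewrite mxE; have [->|/vj //] := eqVneq j i.
  have := vE i; rewrite vD mxE /F eqxx (bigD1 i) //= big1 => [|l /vj ->]; last by rewrite mul0r.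
  by rewrite addr0 => /esym/eqP; rewrite mulf_eq0 => /orP[/eqP //|/eqP].
have [d [L [d0 L0 H]]] := evmap_expansive (mulmxV Du).
exists d => //.
apply: (null_lipschitz (rl := fun q y => y = evmap F q) L0 (hyperplane_null i)).
  move=> q [[Pq _] _]; exists (evmap F q) => //=.
  by rewrite mxE /F eqxx.
by move=> q r y z [_ qd] [_ rd] -> ->; exact: H.
Qed.

Lemma mpoly_nonzero_near N (P : {mpoly R[N]}) p rho : 0 < rho -> P != 0 ->
  exists2 x, `|x - p| <= rho & ev P x != 0.
Proof.
move=> rho0 /mpoly_zero_null nP; apply: contrapT => H.
apply: (@cube_not_null N p rho rho0); apply: null_sub nP => x xp /=.
by apply/eqP; apply: contrapT => /negP Px; apply: H; exists x.
Qed.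


End CubesAndZeroSets.

(** * Finitely multivalued functions of polynomials *)

Section FinitelyValued.
Variable R : realType.

Lemma poly_roots_finite (U : {poly R}) : U != 0 -> exists L : seq R, forall x, root U x -> x \in L.
Proof.
move=> U0; apply: contrapT => H.
have [L [uL rL szL]] : exists L : seq R, [/\ uniq L, all (root U) L & size L = size U].
  elim: (size U) => [|n [L [uL rL szL]]]; first by exists [::].
  have [x [rx xL]] : exists x, root U x /\ x \notin L.
    apply: contrapT => H2; apply: H; exists L => x rx; apply: contrapT => /negP xL.
    by apply: H2; exists x.
  by exists (x :: L); split; rewrite /= ?xL ?rx ?szL.
by have := max_poly_roots U0 rL uL; rewrite szL ltnn.
Qed.

Lemma ev_subst d N (f : 'I_d -> {mpoly R[N]}) Q x :
  ev (subst f Q) x = Q.@[fun i => ev (f i) x].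
Proof. exact: meval_subst. Qed.

Lemma meval_horner d (h : 'I_d -> {poly R}) (Q : {mpoly R[d]}) t :
  (mmap polyC h Q).[t] = Q.@[fun i => (h i).[t]].
Proof.
rewrite mevalE /mmap horner_sum; apply: eq_bigr => m _.
by rewrite hornerM hornerC /mmap1 horner_prod; congr (_ * _); apply: eq_bigr => i _; rewrite horner_exp.
Qed.

Lemma null_translate N (S : set 'rV[R]_N) v : null S -> null [set y | S (y + v)]%classic.
Proof.
move=> nS; apply: (null_lipschitz (rl := fun y z => z = y + v) ltr01 nS).
  by move=> y Sy; exists (y + v).
by move=> q r y z _ _ -> ->; rewrite mul1r opprD addrACA subrr addr0.
Qed.

(** If almost everywhere m takes one of finitely many values determined by those
    of c, then m is algebraic over any transcendence basis c o s of c. *)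
Lemma finitely_valued_algdep N k (c : 'I_k -> {mpoly R[N]}) (m : {mpoly R[N]})
    (Phi : 'rV[R]_k -> seq R) :
  generically [set p | ev m p \in Phi (evmap c p)]%classic ->
  forall r (s : 'I_r -> 'I_k), algindep (c \o s) ->
  (forall l, ~ algindep (fcons (c l) (c \o s))) -> ~ algindep (fcons m (c \o s)).
Proof.
move=> /measure_zero_null; set Bad := (X in null X) => nBad r s inds maxs indm.
have [F [sg [Fs sginj detF]]] := algindep_extend indm.
have /choice [Q QP] : forall l, exists Q, Q != 0 /\ subst (fcons (c l) (c \o s)) Q = 0.
  move=> l; apply: contrapT => H; apply: (maxs l) => Q fQ; apply: contrapT => /eqP Q0.
  by apply: H; exists Q.
(* Choose t l so that Q l remains nonzero when its variable 0, which stands for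
   c l, is set to t l. *)
pose sp l t := subst (fcons (mpolyC r t) (fun i => 'X_i)) (Q l).
have spE l t y : ev (sp l t) y = (Q l).@[fun i => if unlift ord0 i is Some a then y 0 a else t].
  rewrite ev_subst; apply: meval_eq => i; rewrite /fcons; case: unliftP => [a|] _.
    by rewrite /ev mevalXU.
  by rewrite /ev mevalC.
have /choice [t tP] : forall l, exists t, sp l t != 0.
  move=> l; have [x _ Qx] := mpoly_nonzero_near 0 ltr01 (QP l).1.
  exists (x 0 ord0); apply: contraNneq Qx => sp0.
  have := spE l (x 0 ord0) (\row_i x 0 (lift ord0 i)); rewrite sp0 {1}/ev meval0 => E.
  rewrite E; apply/eqP; apply: meval_eq => i; case: unliftP => [a|] -> //; by rewrite mxE.
pose g l := subst (c \o s) (sp l (t l)).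
have g0 l : g l != 0 by apply: contraNneq (tP l) => /inds ->.
(* Near p, F is a bi-Lipschitz open map, and Q l (_, c o s) is a nonzero
   polynomial in one variable. *)
have G0 : \det (jac F) * \prod_l g l != 0.
  by rewrite mulf_neq0 //; apply/prodf_neq0 => l _.
have [p _] := mpoly_nonzero_near 0 ltr01 G0.
rewrite /ev mevalM mulf_eq0 negb_or rmorph_prod => /andP[detp /prodf_neq0 gp].
have Du : dmap F p \in unitmx.
  rewrite unitmxE unitfE -det_tr; apply: contraNneq detp => <-.
  rewrite -det_map_mx; apply/eqP; congr (\det _).
  by apply/matrixP => i j; rewrite !mxE.
have [||dg dg0 gq] := @fin_common_radius R 'I_k (fun l d => forall q, `|q - p| <= d -> ev (g l) q != 0).
- by move=> l d d' _ dd H q qd; apply: H; exact: le_trans dd.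
- move=> l; have e0 : 0 < `|ev (g l) p| / 2 by rewrite divr_gt0 // normr_gt0 gp.
  have [d d0 H] := mpoly_cont (g l) p e0; exists d => // q /H; apply: contraTneq => ->.
  rewrite sub0r normrN -ltNge; move: e0; set a := `|_|; lra.
have [d2 [L [d20 L0 lip]]] := evmap_lipschitz F p.
set dl := Num.min dg d2; have dl0 : 0 < dl by rewrite lt_min dg0.
have [rho rho0 op] := evmap_open dl0 Du.
(* The image of the exceptional set, and its translates in the direction of m,
   are null: they miss a point y. *)
pose FB := [set y | exists q, [/\ Bad q, `|q - p| <= dl & y = evmap F q]]%classic.
have nFB : null FB.
  apply: (null_lipschitz (rl := fun y q => `|q - p| <= d2 /\ y = evmap F q) L0 nBad).
    by move=> y [q [Bq qd yq]]; exists q => //; split=> //; move: qd; rewrite le_min => /andP[].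
  by move=> y y' q q' _ _ [qd ->] [qd' ->]; exact: lip.
pose w (j : nat) : R := rho / 2 / j.+1%:R.
have w0 j : 0 < w j by rewrite !divr_gt0 ?ltr0n.
have wle j : w j <= rho / 2.
  by rewrite ler_pdivrMr ?ltr0n // ler_peMr ?divr_ge0 ?(ltW rho0) // ler1n.
pose v (j : nat) : 'rV[R]_N := \row_i (if i == sg ord0 then w j else 0).
have nT : null [set y | exists j, FB (y + v j)]%classic.
  by apply: (null_bigcup (T := fun j => [set y | FB (y + v j)]%classic)) => // j; exact: null_translate.
have [y [yF yB]] : exists y, `|y - evmap F p| <= rho / 2 /\ forall j, ~ FB (y + v j).
  apply: contrapT => H; have r20 : 0 < rho / 2 by rewrite divr_gt0.
  apply: (@cube_not_null R N (evmap F p) _ r20); apply: null_sub nT => y /= yF.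
  by apply: contrapT => H2; apply: H; exists y; split=> // j FBj; apply: H2; exists j.
have [x' x'd Fx'] : exists2 x, `|x - p| <= dl & evmap F x = y.
  by apply: op; apply: le_trans yF _; rewrite ler_piMr ?(ltW rho0) // invf_le1 // ler1n.
(* The points x j avoid the exceptional set, have the same c o s and distinct m. *)
have /choice [x xP] : forall j, exists x, `|x - p| <= dl /\ evmap F x = y + v j.
  move=> j; have [|x xd Fx] := op (y + v j); last by exists x.
  rewrite addrAC; apply: le_trans (ler_normD _ _) _.
  rewrite [leRHS]splitr lerD //; apply: norm_rV_le; first by rewrite divr_ge0 // ltW.
  move=> i; rewrite mxE; case: eqP => _; last by rewrite normr0 divr_ge0 // ltW.
  by rewrite gtr0_norm.
have xm j : ev m (x j) \in Phi (evmap c (x j)).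
  apply: contrapT => /negP Bx; apply: (yB j); exists (x j); split; [|exact: (xP j).1|by rewrite (xP j).2].
  by move=> /= h; rewrite h in Bx.
pose z a := y 0 (sg (lift ord0 a)).
have cx j a : ev (c (s a)) (x j) = z a.
  have /rowP /(_ (sg (lift ord0 a))) := (xP j).2; rewrite !mxE Fs fconsS /= => ->.
  by rewrite (inj_eq sginj) addr0.
have cx' a : ev (c (s a)) x' = z a.
  by have /rowP /(_ (sg (lift ord0 a))) := Fx'; rewrite !mxE Fs fconsS.
have mx j : ev m (x j) = y 0 (sg ord0) + w j.
  by have /rowP /(_ (sg ord0)) := (xP j).2; rewrite !mxE Fs fcons0 eqxx.
pose U l : {poly R} := mmap polyC (fun i => if unlift ord0 i is Some a then (z a)%:P else 'X) (Q l).
have UE l u : (U l).[u] = (Q l).@[fun i => if unlift ord0 i is Some a then z a else u].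
  rewrite meval_horner; apply: meval_eq => i; case: unliftP => [a|] _; first by rewrite hornerC.
  by rewrite hornerX.
have U0 l : U l != 0.
  have [xdg _] : `|x' - p| <= dg /\ `|x' - p| <= d2 by apply/andP; rewrite -le_min.
  have := gq l x' xdg; apply: contraNneq => Ul0.
  rewrite ev_subst -/(ev _ (\row_a _)).
  have := UE l (t l); rewrite Ul0 horner0 => E.
  have -> : (sp l (t l)).@[fun i => ev ((c \o s) i) x'] = ev (sp l (t l)) (\row_a z a).
    by apply: meval_eq => a; rewrite mxE cx'.
  rewrite spE E; apply/eqP; apply: meval_eq => i; by case: unliftP => [a|] _ //; rewrite mxE.
have Uroot l j : root (U l) (ev (c l) (x j)).
  have E : ev (subst (fcons (c l) (c \o s)) (Q l)) (x j) = 0 by rewrite (QP l).2; exact: meval0.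
  rewrite rootE UE -E ev_subst; apply/eqP; apply: meval_eq => i.
  by rewrite /fcons; case: unliftP => [a|] _ //=; rewrite cx.
(* All the c l (x j) lie in finite sets of roots, so c (x j) takes finitely many
   values. *)
have /choice [Ls LsP] : forall l, exists L : seq R, forall x, root (U l) x -> x \in L.
  by move=> l; exact: poly_roots_finite.
pose D := (\max_l size (Ls l)).+1%N.
pose vec (h : {ffun 'I_k -> 'I_D}) : 'rV[R]_k := \row_l nth 0 (Ls l) (h l).
pose All := flatten [seq Phi (vec h) | h <- enum {: {ffun 'I_k -> 'I_D}}].
have mAll j : ev m (x j) \in All.
  have iD l : (index (ev (c l) (x j)) (Ls l) < D)%N.
    by rewrite ltnS; apply: leq_trans (index_size _ _) _; exact: leq_bigmax.
  apply/flatten_mapP; exists [ffun l => Ordinal (iD l)]; first by rewrite mem_enum.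
  have -> : vec [ffun l => Ordinal (iD l)] = evmap c (x j); last exact: xm.
  by apply/rowP => l; rewrite !mxE ffunE /= nth_index // LsP.
have um : uniq [seq ev m (x j) | j <- iota 0 (size All).+1].
  rewrite map_inj_uniq ?iota_uniq // => i j; rewrite !mx => /addrI.
  rewrite /w => /mulfI; rewrite mulf_neq0 ?invr_neq0 ?lt0r_neq0 // => /(_ isT) /invr_inj /eqP.
  by rewrite eqr_nat eqSS => /eqP.
have : (size [seq ev m (x j) | j <- iota 0 (size All).+1] <= size All)%N.
  by apply: uniq_leq_size um _ => _ /mapP [j _ ->].
by rewrite size_map size_iota ltnn.
Qed.

End FinitelyValued.

(** * Potentials on directed graphs *)

Section Potential.
Variables (K : zmodType) (n : nat) (G : {set 'I_n * 'I_n}) (In Out : {set 'I_n}).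
Variable w : 'I_n * 'I_n -> K.

(** Total weight of the walk x :: s. *)
Definition walk_weight x s : K := \sum_(e <- walk_edges x s) w e.

Lemma walk_edges_cat (x : 'I_n) s1 s2 :
  walk_edges x (s1 ++ s2) = walk_edges x s1 ++ walk_edges (last x s1) s2.
Proof.
elim: s1 x => [|y s1 IH] x //=.
by rewrite [LHS](_ : _ = (x, y) :: walk_edges y (s1 ++ s2)) // IH.
Qed.

Lemma walk_weight_cons x y s : walk_weight x (y :: s) = w (x, y) + walk_weight y s.
Proof. by rewrite /walk_weight /walk_edges /= big_cons. Qed.

Lemma walk_weight_cat x s1 s2 :
  walk_weight x (s1 ++ s2) = walk_weight x s1 + walk_weight (last x s1) s2.
Proof. by rewrite /walk_weight walk_edges_cat big_cat. Qed.

Hypothesis cycle0 : forall es, is_cycle G es -> \sum_(e <- es) w e = 0.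
Hypothesis iopath0 : forall es, is_io_path G In Out es -> \sum_(e <- es) w e = 0.

(** Removing cycles from a walk does not change its weight. *)
Lemma loop_erasure x s : path (arc_rel G) x s ->
  exists s', [/\ path (arc_rel G) x s', uniq (x :: s'), last x s' = last x s
    & walk_weight x s' = walk_weight x s].
Proof.
elim: s x => [|y s IH] x; first by exists [::].
move=> /= /andP[xy /IH [s' [ps us ls ws]]].
have [xin|xnin] := boolP (x \in y :: s'); last first.
  exists (y :: s'); split; [by rewrite /= xy|by rewrite cons_uniq xnin|by rewrite /= ls|].
  by rewrite !walk_weight_cons ws.
have pxs : path (arc_rel G) x (y :: s') by rewrite /= xy.
have lxs : last x (y :: s') = last y s by rewrite /= ls.
have wxs : walk_weight x (y :: s') = walk_weight x (y :: s) by rewrite !walk_weight_cons ws.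
move: us pxs lxs wxs; case/path.splitP: xin => u v; rewrite cat_uniq rcons_uniq cat_path walk_weight_cat.
rewrite last_cat !last_rcons => /and3P[/andP[xu uu] hasv uv] /andP[pu pv] lv wv.
exists v; split=> //=.
  rewrite uv andbT; apply: contra hasv => xv; apply/hasP; exists x => //.
  by rewrite /= mem_rcons mem_head.
rewrite -wv [walk_weight x (rcons u x)]cycle0 ?add0r //.
by exists x, u; split=> //=; rewrite xu.
Qed.

(** There is a walk of weight t from x to y in G. *)
Definition gwalk x y t := exists s, [/\ path (arc_rel G) x s, last x s = y & walk_weight x s = t].

Lemma gwalk_cat x y z t u : gwalk x y t -> gwalk y z u -> gwalk x z (t + u).
Proof.
move=> [s1 [p1 l1 <-]] [s2 [p2 l2 <-]]; exists (s1 ++ s2).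
by rewrite cat_path p1 l1 p2 last_cat l1 l2 walk_weight_cat l1.
Qed.

Lemma gwalk_refl x : gwalk x x 0.
Proof. by exists [::]; rewrite /walk_weight /walk_edges /= big_nil. Qed.

Lemma gwalk_closed x t : gwalk x x t -> t = 0.
Proof.
move=> [s [ps ls <-]]; have [s' [_ us ls' <-]] := loop_erasure ps.
rewrite ls in ls'; case: s' us ls' => [|y s'] us ls'.
  by rewrite /walk_weight /walk_edges /= big_nil.
by move: us; rewrite cons_uniq -{1}ls' /= mem_last.
Qed.

Lemma gwalk_io i o t : i \in In -> o \in Out -> gwalk i o t -> t = 0.
Proof.
move=> iI oO [s [ps ls <-]]; have [s' [ps' us' ls' <-]] := loop_erasure ps.
by apply: iopath0; exists i, s'; rewrite ls' ls.
Qed.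

(** The same for walks which may also jump, with weight 0, from an output to an
    input.  Walks from input to output have weight 0, so one jump is enough. *)
Definition jwalk x y t := gwalk x y t \/
  exists o i a b, [/\ o \in Out, i \in In, gwalk x o a, gwalk i y b & t = a + b].

Lemma jwalk_cat x y z t u : jwalk x y t -> jwalk y z u -> jwalk x z (t + u).
Proof.
move=> [g1|[o [i [a [b [oO iI g1 g2 ->]]]]]] [h1|[o' [i' [a' [b' [oO' iI' h1 h2 ->]]]]]].
- by left; exact: gwalk_cat h1.
- by right; exists o', i', (t + a'), b'; rewrite -addrA; split=> //; exact: gwalk_cat h1.
- by right; exists o, i, a, (b + u); rewrite addrA; split=> //; exact: gwalk_cat h1.
right; exists o, i', a, b'; split=> //.
by rewrite addrA -(addrA a) (gwalk_io iI oO' (gwalk_cat g2 h1)) addr0.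
Qed.

Lemma jwalk_closed x t : jwalk x x t -> t = 0.
Proof.
move=> [/gwalk_closed //|[o [i [a [b [oO iI g1 g2 ->]]]]]].
by rewrite addrC (gwalk_io iI oO (gwalk_cat g2 g1)).
Qed.

(** The graph G with an added edge from each output to each input. *)
Definition jump_rel : rel 'I_n := [rel x y | arc_rel G x y || (x \in Out) && (y \in In)].

Lemma jwalk_arc x y : (x, y) \in G -> jwalk x y (w (x, y)).
Proof.
move=> xy; left; exists [:: y]; split=> //=; first by rewrite /arc_rel /= xy.
by rewrite walk_weight_cons /walk_weight /walk_edges /= big_nil addr0.
Qed.

Lemma jwalk_jump x y : x \in Out -> y \in In -> jwalk x y 0.
Proof. by move=> xO yI; right; exists x, y, 0, 0; rewrite addr0; split=> //; exact: gwalk_refl. Qed.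

Lemma jwalk_connect x y : connect jump_rel x y -> exists t, jwalk x y t.
Proof.
move=> /connectP [s ps ->]; elim: s x ps => [|z s IH] x /=.
  by move=> _; exists 0; left; exact: gwalk_refl.
move=> /andP[xz /IH [t zt]].
case/orP: xz => [xz|/andP[xO zI]].
  by exists (w (x, z) + t); apply: jwalk_cat zt; exact: jwalk_arc.
by exists (0 + t); apply: jwalk_cat zt; exact: jwalk_jump.
Qed.

(** Fixing an input x0, the potential of y is the weight of all walks with jumps
    from x0 to y. *)
Lemma potential : In != finset.set0 -> Out != finset.set0 -> (forall x y, connect jump_rel x y) ->
  exists phi : 'I_n -> K, (forall i j, (i, j) \in G -> w (i, j) = phi j - phi i) /\
    forall i, i \in In :|: Out -> phi i = 0.
Proof.
move=> /set0Pn [x0 x0I] /set0Pn [o0 o0O] conn.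
have /choice [phi phiP] : forall y, exists t, jwalk x0 y t by move=> y; exact: jwalk_connect.
have uniq_t y t : jwalk x0 y t -> t = phi y.
  move=> yt; have [u yu] := jwalk_connect (conn y x0).
  apply: (addIr u); rewrite (jwalk_closed (jwalk_cat yt yu)).
  by rewrite (jwalk_closed (jwalk_cat (phiP y) yu)).
have phi0 : phi x0 = 0 by apply: jwalk_closed (phiP x0).
have jump o i : o \in Out -> i \in In -> phi o = phi i.
  move=> oO iI; rewrite -(uniq_t i (phi o + 0)) ?addr0 // -[X in jwalk _ _ X]addr0.
  by apply: jwalk_cat (phiP o) _; exact: jwalk_jump.
exists phi; split=> [i j ij|i].
  by rewrite -(uniq_t j (phi i + w (i, j))) ?(addrC (phi i)) ?addrK //; rewrite addrC;
     apply: jwalk_cat (phiP i) _; exact: jwalk_arc.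
by rewrite inE => /orP[iI|iO]; [rewrite -(jump _ _ o0O iI)|]; rewrite (jump _ _ _ x0I).
Qed.

End Potential.

Section Connectivity.
Variables (n : nat) (G : {set 'I_n * 'I_n}) (In Out : {set 'I_n}).

Lemma walk_edge_split x s (e : 'I_n * 'I_n) : path (arc_rel G) x s -> e \in walk_edges x s ->
  connect (arc_rel G) x e.1 /\ connect (arc_rel G) e.2 (last x s).
Proof.
elim: s x => [|y s IH] x /=; first by rewrite /walk_edges.
move=> /andP[xy ps]; rewrite /walk_edges /= inE => /orP[/eqP -> /=|/(IH _ ps) [c1 c2]].
  by split=> //; apply/connectP; exists s.
by split=> //; apply: connect_trans (connect1 _) c1.
Qed.

Lemma jump_connected :
  strongly_connected G \/ strongly_io_connected G In Out ->
  forall x y, connect (jump_rel G In Out) x y.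
Proof.
have sub x y : connect (arc_rel G) x y -> connect (jump_rel G In Out) x y.
  by apply: connect_sub => u v uv; apply/connect1/orP; left.
case=> [sc x y|[wc cov] x y]; first exact: sub.
apply: (connect_sub _ (wc x y)) => u v /= /orP[uv|vu]; first by apply/sub/connect1.
have [es H ees] := cov _ vu.
case: H => [[z [s [cs us E]]]|[z [s [ps us zI lO E]]]]; rewrite E in ees.
  have [/= c1 c2] := walk_edge_split cs ees; rewrite last_rcons in c2.
  by apply: sub; exact: connect_trans c2 c1.
have [/= c1 c2] := walk_edge_split ps ees.
have jz : jump_rel G In Out (last z s) z by apply/orP; right; rewrite lO zI.
exact: connect_trans (sub _ _ c2) (connect_trans (connect1 jz) (sub _ _ c1)).
Qed.

Lemma path_edges x s : path (arc_rel G) x s -> {subset walk_edges x s <= G}.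
Proof.
elim: s x => [|y s IH] x //= /andP[xy ps] e; rewrite inE => /orP[/eqP -> //|]; exact: IH.
Qed.

Lemma monomial_edges es : is_cycle G es \/ is_io_path G In Out es -> {subset es <= G}.
Proof. by case=> [[x [s [ps _ ->]]]|[x [s [ps _ _ _ ->]]]]; exact: path_edges. Qed.

End Connectivity.

(** * Rank of the coefficient map with all leaks *)

Section Deriv.
Variables (R : realType) (N : nat).
Local Notation K := {fraction {mpoly R[N]}}.
Variable v : 'I_N -> K.

(** The derivation of direction v from polynomials to rational functions. *)
Definition deriv (P : {mpoly R[N]}) : K := \sum_u (mderiv u P)%:F * v u.

Lemma derivD P Q : deriv (P + Q) = deriv P + deriv Q.
Proof. by rewrite /deriv -big_split; apply: eq_bigr => u _; rewrite mderivD rmorphD mulrDl. Qed.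
Lemma derivN P : deriv (- P) = - deriv P.
Proof. by rewrite /deriv -sumrN; apply: eq_bigr => u _; rewrite mderivN rmorphN mulNr. Qed.
Lemma deriv0 : deriv 0 = 0.
Proof. by rewrite /deriv big1 // => u _; rewrite mderiv0 rmorph0 mul0r. Qed.
Lemma deriv1 : deriv 1 = 0.
Proof. by rewrite /deriv big1 // => u _; rewrite -mpolyC1 mderivC rmorph0 mul0r. Qed.
Lemma derivM P Q : deriv (P * Q) = deriv P * Q%:F + P%:F * deriv Q.
Proof.
rewrite /deriv mulr_suml mulr_sumr -big_split; apply: eq_bigr => u _ /=.
by rewrite mderivM rmorphD !rmorphM mulrDl mulrAC mulrA.
Qed.
Lemma deriv_sum (I : finType) (P : pred I) (F : I -> {mpoly R[N]}) :
  deriv (\sum_(i | P i) F i) = \sum_(i | P i) deriv (F i).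
Proof. exact: (big_morph _ derivD deriv0). Qed.

Lemma derivX u : deriv 'X_u = v u.
Proof.
rewrite /deriv (bigD1 u) //= big1 ?addr0 => [|k ku].
  by rewrite mderiv_var eqxx rmorph1 mul1r.
by rewrite mderiv_var eq_sym (negPf ku) rmorph0 mul0r.
Qed.

Lemma deriv_prod (T : eqType) (F : T -> {mpoly R[N]}) (s : seq T) :
  (forall e, e \in s -> F e != 0) ->
  deriv (\prod_(e <- s) F e) = (\prod_(e <- s) F e)%:F * \sum_(e <- s) deriv (F e) / (F e)%:F.
Proof.
elim: s => [|e s IH] F0; first by rewrite !big_nil deriv1 mulr0.
rewrite !big_cons derivM IH => [|f fs]; last by apply: F0; rewrite inE fs orbT.
have Fe : (F e)%:F != 0 by rewrite tofrac_eq0 F0 // mem_head.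
rewrite mulrDr rmorphM; congr (_ + _); last by rewrite mulrA.
by rewrite -mulrA mulrCA [_ * (_ / _)]mulrCA mulfV // mulr1 mulrC.
Qed.

Lemma deriv_algdep d (f : 'I_d -> {mpoly R[N]}) m :
  algindep f -> ~ algindep (fcons m f) -> (forall l, deriv (f l) = 0) -> deriv m = 0.
Proof.
move=> indf depm f0; have [g [w g0 E]] := algdep_gradient indf depm.
have gF : g%:F != 0 by rewrite tofrac_eq0.
apply: (mulfI gF); rewrite mulr0 /deriv mulr_sumr.
transitivity (\sum_l (w l)%:F * deriv (f l)); last by rewrite big1 // => l _; rewrite f0 mulr0.
rewrite (eq_bigr (fun u => \sum_l (w l)%:F * ((mderiv u (f l))%:F * v u))).
  by rewrite exchange_big; apply: eq_bigr => l _; rewrite mulr_sumr.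
move=> u _; rewrite mulrA -rmorphM E rmorph_sum mulr_suml; apply: eq_bigr => l _.
by rewrite rmorphM mulrA.
Qed.

End Deriv.

Section FullRank.
Variables (R : realType) (n : nat) (G : {set 'I_n * 'I_n}) (In Out : {set 'I_n}).
Local Notation VV := [set: 'I_n]%SET.
Local Notation PP := (ppoly R G VV).
Local Notation NV := (nparam G VV).
Local Notation K := {fraction PP}.
Local Notation cfs := (coefs R G In Out VV).
(** The coefficients of the model with leaks in L, as a family. *)
Definition coef_fam (L : {set 'I_n}) : 'I_(size (coefs R G In Out L)) -> ppoly R G L :=
  fun l => (coefs R G In Out L)`_l.
Arguments coef_fam L l : clear implicits.

Lemma algindep_tnth N d (B : d.-tuple {mpoly R[N]}) : alg_independent B <-> algindep (tnth B).
Proof.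
have E Q : subst (tnth B) Q = comp_mpoly B Q.
  by rewrite /subst; congr comp_mpoly; apply: eq_from_tnth => i; rewrite tnth_mktuple.
by split=> H Q HQ; apply: H; rewrite ?E // -E.
Qed.

Lemma deriv_monomial (v : 'I_NV -> K) m :
  identifiable_path_cycle_model R G In Out ->
  (forall l, deriv v (coef_fam VV l) = 0) -> path_cycle_monomial In Out m -> deriv v m = 0.
Proof.
move=> [[d [B [[BP Bind Bmax] Bid]]] _] c0 mP.
have [r [s [inds maxs]]] := max_algindep_subfamily (coef_fam VV).
have B0 b : b \in B -> deriv v b = 0.
  move=> /Bid [Phi gen]; apply: (deriv_algdep inds) => [|l]; last exact: c0.
  exact: (finitely_valued_algdep (Phi := Phi) gen inds maxs).
apply: (deriv_algdep (f := tnth B)); first exact: (algindep_tnth B).1 Bind.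
  move=> H; apply: (Bmax m mP); apply: (algindep_tnth _).2; apply: eq_algindep H => i.
  rewrite /fcons; case: unliftP => [j|] ->; last by rewrite tnth0.
  by rewrite tnthS.
by move=> l; apply: B0; exact: mem_tnth.
Qed.

Lemma pvar_neq0 L (u : param G L) : pvar R u != 0.
Proof. by rewrite -msize_poly_eq0 msizeX. Qed.

Lemma edge_paramE L e (eG : e \in G) : edge_param R G L e = pvar R (inl (Sub e eG)).
Proof. by rewrite /edge_param insubT. Qed.

Lemma edge_param_neq0 L e : e \in G -> edge_param R G L e != 0.
Proof. by move=> eG; rewrite edge_paramE pvar_neq0. Qed.

Lemma leak_paramE (i : 'I_n) (iL : i \in VV) : leak_param R G VV i = pvar R (inr (Sub i iL)).
Proof. by rewrite /leak_param insubT. Qed.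

(** The infinitesimal action on the parameters of the diagonal matrix phi by
    conjugation: it moves the edge parameter a_ij by a_ij (phi i - phi j) and
    the leaks so that the diagonal entries do not change.  Here an edge is the
    pair (source, target). *)
Definition torus_tangent (phi : 'I_n -> K) (u : param G VV) : K :=
  match u with
  | inl e => (edge_param R G VV (val e))%:F * (phi (val e).2 - phi (val e).1)
  | inr i => - \sum_(k | (val i, k) \in G) (edge_param R G VV (val i, k))%:F * (phi k - phi (val i))
  end.

Lemma deriv_pvar (v : 'I_NV -> K) u : deriv v (pvar R u) = v (enum_rank u).
Proof. exact: derivX. Qed.

(** A vector in the kernel of the Jacobian of the coefficients is tangent to the
    action of the diagonal matrices which are trivial on inputs and outputs. *)
Lemma kernel_torus_tangent (v : 'I_NV -> K) :
  In != finset.set0 -> Out != finset.set0 -> (forall x y, connect (jump_rel G In Out) x y) ->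
  identifiable_path_cycle_model R G In Out ->
  (forall l, deriv v (coef_fam VV l) = 0) ->
  exists phi : 'I_n -> K, (forall i, i \in In :|: Out -> phi i = 0) /\
    forall u, v (enum_rank u) = torus_tangent phi u.
Proof.
move=> I0 O0 conn ident c0.
(* The logarithmic derivatives of the edge parameters. *)
pose w e := deriv v (edge_param R G VV e) / (edge_param R G VV e)%:F.
have w0 es : is_cycle G es \/ is_io_path G In Out es -> \sum_(e <- es) w e = 0.
  move=> esP; have es0 e : e \in es -> edge_param R G VV e != 0.
    by move=> /(monomial_edges esP); exact: edge_param_neq0.
  have : deriv v (\prod_(e <- es) edge_param R G VV e) = 0.
    by apply: (deriv_monomial ident c0); right; exists es.
  rewrite deriv_prod // => /eqP; rewrite mulf_eq0 tofrac_eq0 prodf_seq_eq0.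
  case/orP => [/hasP [e /es0 /negPf]|/eqP //]; by rewrite /= => ->.
have [||phi [wphi phi0]] := @potential _ n G In Out w _ _ I0 O0 conn.
- by move=> es H; apply: w0; left.
- by move=> es H; apply: w0; right.
exists phi; split=> //.
have De e : e \in G -> deriv v (edge_param R G VV e) = (edge_param R G VV e)%:F * (phi e.2 - phi e.1).
  case: e => i j eG /=; rewrite -(wphi i j eG) /w mulrC divfK // tofrac_eq0; exact: edge_param_neq0.
case=> [[e eG]|[i iL]]; rewrite -deriv_pvar /torus_tangent.
  by rewrite -[pvar _ _](edge_paramE VV eG) De.
have : deriv v (compartmental_mx R G VV i i) = 0.
  by apply: (deriv_monomial ident c0); left; exists i.
rewrite mxE eqxx derivD !derivN deriv_sum (leak_paramE iL) => /eqP.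
rewrite addr_eq0 opprK => /eqP E; apply: oppr_inj; rewrite opprK E.
by apply: eq_bigr => k ik; rewrite De.
Qed.

Lemma torus_tangent_decomp (phi : 'I_n -> K) : (forall i, i \in In :|: Out -> phi i = 0) ->
  forall u, torus_tangent phi u =
   \sum_(a < #|~: (In :|: Out)|) phi (enum_val a) * torus_tangent (fun i => (i == enum_val a)%:R) u.
Proof.
move=> phi0; set W := ~: (In :|: Out).
have phiE i : phi i = \sum_(a < #|W|) phi (enum_val a) * (i == enum_val a)%:R.
  have [iS|iW] := boolP (i \in In :|: Out).
    rewrite phi0 // big1 // => a _; case: eqP => [E|]; last by rewrite mulr0.
    by have := enum_valP a; rewrite -E inE iS.
  have iW' : i \in W by rewrite inE.
  rewrite (bigD1 (enum_rank_in iW' i)) //= enum_rankK_in // eqxx mulr1 big1 ?addr0 // => a ai.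
  case: eqP => [E|]; last by rewrite mulr0.
  by case/eqP: ai; apply: enum_val_inj; rewrite enum_rankK_in.
have diffE i j : phi j - phi i =
    \sum_(a < #|W|) phi (enum_val a) * ((j == enum_val a)%:R - (i == enum_val a)%:R).
  by rewrite (phiE i) (phiE j) -sumrB; apply: eq_bigr => a _; rewrite mulrBr.
case=> [e|i] /=.
  by rewrite diffE mulr_sumr; apply: eq_bigr => a _; rewrite mulrCA.
rewrite -sumrN; under [LHS]eq_bigr => k _ do rewrite diffE mulr_sumr -sumrN.
rewrite exchange_big; apply: eq_bigr => a _ /=.
by rewrite mulrN mulr_sumr -sumrN; apply: eq_bigr => k _; rewrite mulrCA.
Qed.

Lemma card_params L : nparam G L = (#|G| + #|L|)%N.
Proof. by rewrite /nparam card_sum !card_sig. Qed.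

Lemma full_rank :
  In != finset.set0 -> Out != finset.set0 -> (forall x y, connect (jump_rel G In Out) x y) ->
  identifiable_path_cycle_model R G In Out ->
  exists r (f : 'I_r -> 'I_(size cfs)), algindep (coef_fam VV \o f) /\ (#|G| + #|In :|: Out| <= r)%N.
Proof.
move=> I0 O0 conn ident; pose J := map_mx (@tofrac _) (jac (coef_fam VV)).
exists (\rank J), (maxrankfun J); split.
  apply: jac_free_algindep.
  have -> : map_mx (@tofrac _) (jac (coef_fam VV \o maxrankfun J)) = rowsub (maxrankfun J) J.
    by apply/matrixP => i j; rewrite !mxE.
  exact: maxrowsub_free.
pose W := ~: (In :|: Out).
pose Psi : 'M[K]_(#|W|, NV) :=
  \matrix_(a, u) torus_tangent (fun i => (i == enum_val a)%:R) (enum_val u).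
have : (kermx J^T <= Psi)%MS.
  apply/row_subP => i; set v := row i _.
  have vJ : v *m J^T = 0 by apply: sub_kermxP; exact: row_sub.
  have [|phi [phi0 vphi]] := kernel_torus_tangent (v := fun u => v 0 u) I0 O0 conn ident.
    move=> l; have /rowP /(_ l) := vJ; rewrite [RHS]mxE mxE => E; rewrite -[RHS]E.
    by apply: eq_bigr => u _; rewrite !mxE mulrC.
  apply/submxP; exists (\row_a phi (enum_val a)); apply/rowP => u.
  rewrite -[u in LHS]enum_valK vphi torus_tangent_decomp // mxE.
  by apply: eq_bigr => a _; rewrite !mxE.
move=> /mxrankS; rewrite mxrank_ker mxrank_tr => H.
have := leq_trans H (rank_leq_row _); move: (\rank J) => r.
have := cardsC (In :|: Out); rewrite card_ord card_params cardsT card_ord leq_subLR /W => E H'.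
by rewrite -(leq_add2r #|~: (In :|: Out)|) -addnA E.
Qed.

End FullRank.

(** * The torus action on compartmental matrices *)

Arguments coef_fam R {n} G In Out L l.

Section Coefficients.
Variable n : nat.

(** Names for the coefficients of the input-output equations which do not depend
    on the leaks: inl t for that of degree t in the characteristic polynomial,
    inr (i, j, t) for that of degree t in the cofactor (i, j).  The coefficients
    equal to 0 or 1 are dropped from the coefficient map, so positions in the
    map vary with the set of leaks. *)
Definition label := (nat + 'I_n * 'I_n * nat)%type.

Definition char_coef (T : comNzRingType) (A : 'M[T]_n) (l : label) : T :=
  match l with
  | inl t => (char_poly A)`_t
  | inr (i, j, t) => (cofactor (char_poly_mx A) i j)`_t
  end.

Definition valid_label (In Out : {set 'I_n}) (l : label) : bool :=
  if l is inr (i, j, _) then (i \in In) && (j \in Out) else true.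

Lemma map_char_coef (T T' : comNzRingType) (f : {rmorphism T -> T'}) (A : 'M[T]_n) l :
  char_coef (map_mx f A) l = f (char_coef A l).
Proof.
case: l => [t|[[i j] t]] /=; first by rewrite -map_char_poly poly.coef_map.
by rewrite -map_char_poly_mx cofactor_map_mx poly.coef_map.
Qed.

Lemma adjugate_conj (T : idomainType) (M D D' : 'M[T]_n) : \det M != 0 ->
  D *m D' = 1%:M -> D' *m D = 1%:M -> \adj (D *m M *m D') = D *m \adj M *m D'.
Proof.
move=> M0 DD' D'D; set M' := D *m M *m D'.
have detM' : \det M' = \det M.
  by rewrite !det_mulmx mulrAC -det_mulmx DD' det1 mul1r.
have E : M' *m \adj M' = M' *m (D *m \adj M *m D').
  rewrite mul_mx_adj detM' /M' !mulmxA -(mulmxA (D *m M)) D'D mulmx1 -(mulmxA D) mul_mx_adj.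
  by rewrite mul_mx_scalar -scalemxAl DD' scalemx1.
have /matrixP E2 : \det M' *: \adj M' = \det M' *: (D *m \adj M *m D').
  by rewrite -!mul_scalar_mx -mul_adj_mx -(mulmxA _ M' (\adj M')) E mulmxA.
apply/matrixP => i j; have := E2 i j; rewrite [LHS]mxE [RHS]mxE; apply: mulfI.
by rewrite detM'.
Qed.

(** Entry (j, i) of the adjugate, that is, the cofactor (i, j), is multiplied by
    d j / d i, which is 1 for an input i and an output j. *)
Lemma char_coef_conj (F : fieldType) (In Out : {set 'I_n}) (A : 'M[F]_n) (d : 'I_n -> F) l :
  (forall i, d i != 0) -> (forall i, i \in In :|: Out -> d i = 1) ->
  valid_label In Out l ->
  char_coef (\matrix_(i, j) (d i * A i j / d j)) l = char_coef A l.
Proof.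
move=> d0 d1 vl; set A' := \matrix_(i, j) _.
pose D := diag_mx (\row_i (d i)%:P); pose D' := diag_mx (\row_i (d i)^-1%:P).
have DD' : D *m D' = 1%:M.
  rewrite mulmx_diag -diag_const_mx; congr diag_mx; apply/rowP => i.
  by rewrite !mxE -polyCM mulfV.
have D'D : D' *m D = 1%:M.
  rewrite mulmx_diag -diag_const_mx; congr diag_mx; apply/rowP => i.
  by rewrite !mxE -polyCM mulVf.
have E : char_poly_mx A' = D *m char_poly_mx A *m D'.
  apply/matrixP => i j; rewrite mul_mx_diag mul_diag_mx !mxE mulrBr mulrBl.
  rewrite -!polyCM; congr (_ - _).
  case: eqP => [->|]; last by rewrite mulr0n mulr0 mul0r.
  by rewrite mulr1n mulrAC -polyCM mulfV // mul1r.
have cp0 : \det (char_poly_mx A) != 0 by apply: monic_neq0; exact: char_poly_monic.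
case: l vl => [t|[[i j] t]] /=.
  by rewrite /char_poly E !det_mulmx mulrAC -det_mulmx DD' det1 mul1r.
move=> /andP[iI jO].
have adjE (M : 'M[{poly F}]_n) : cofactor M i j = (\adj M) j i by rewrite mxE.
rewrite !adjE E adjugate_conj // mul_mx_diag mul_diag_mx !mxE.
by rewrite !d1 ?inE ?iI ?jO ?orbT // invr1 mul1r mulr1.
Qed.

End Coefficients.

(** ** Balancing a column-diagonally dominant matrix *)

Section BalancingWeights.
Variables (R : realType) (n : nat) (G : {set 'I_n * 'I_n}) (In Out : {set 'I_n}).
Local Notation S := (In :|: Out).
Variable A : 'M[R]_n.
Hypothesis Apos : forall i j, (j, i) \in G -> 0 < A i j.
Hypothesis Aoff : forall i j, i != j -> 0 <= A i j.
Hypothesis Aleak : forall j, \sum_i A i j < 0.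
Hypothesis I0 : In != finset.set0.
Hypothesis conn : forall x y, connect (jump_rel G In Out) x y.

(** The linear system which expresses that x is prescribed on S, and that x A is 0
    outside S. *)
Let B : 'M[R]_n := \matrix_(i, j) if j \in S then (i == j)%:R else A i j.

Let mulB (x : 'rV_n) j : (x *m B) 0 j = if j \in S then x 0 j else \sum_i x 0 i * A i j.
Proof.
rewrite mxE; case: ifP => jS; last by apply: eq_bigr => i _; rewrite mxE jS.
rewrite (bigD1 j) //= mxE jS eqxx mulr1 big1 ?addr0 // => i ij.
by rewrite mxE jS (negPf ij) mulr0.
Qed.

(** Maximum principle: a solution of the homogeneous system attains its largest
    absolute value on S, where it is 0. *)
Let B_unit : B \in unitmx.
Proof.
rewrite -row_free_unit; apply: inj_row_free => x xB.
have [i0 _] := set0Pn _ I0.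
have [j _ jmax] := @Order.TotalTheory.arg_maxP _ _ 'I_n i0 xpredT (fun i => `|x 0 i|) isT.
suff xj : x 0 j = 0.
  apply/rowP => i; rewrite mxE; apply/eqP; rewrite -normr_le0.
  by apply: le_trans (jmax i isT) _; rewrite xj normr0.
have := mulB x j; rewrite xB mxE; case: ifP => // jS.
rewrite (bigD1 j) //= => /esym/eqP; rewrite addr_eq0 => /eqP E.
apply/eqP; rewrite -normr_le0 leNgt; apply/negP => xj0.
have := Aleak j; rewrite (bigD1 j) //=; set T := \sum_(i | _) _ => lk.
have T0 : 0 <= T by apply: sumr_ge0 => i ij; exact: Aoff.
have : `|x 0 j * A j j| <= `|x 0 j| * T.
  rewrite E normrN; apply: le_trans (ler_norm_sum _ _ _) _.
  rewrite mulr_sumr; apply: ler_sum => i ij; rewrite normrM (ger0_norm (Aoff ij)).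
  by apply: ler_wpM2r; [exact: Aoff|exact: jmax].
rewrite normrM ler_pM2l // leNgt; apply/negP/negPn.
by rewrite ltr0_norm; lra.
Qed.

(** Weights d such that the columns of d i * A i j / d j outside S sum to 0.  A
    negative minimum of d outside S would contradict the leaks, and a zero of d
    would propagate along edges up to S, where d is 1. *)
Lemma balancing_weights : exists d : 'I_n -> R,
  [/\ forall i, 0 < d i, forall i, i \in S -> d i = 1
    & forall j, j \notin S -> \sum_i d i * A i j = 0].
Proof.
pose b : 'rV[R]_n := \row_j (j \in S)%:R; pose d := b *m invmx B.
have dB : d *m B = b by rewrite mulmxKV.
have d1 i : i \in S -> d 0 i = 1.
  by move=> iS; have := mulB d i; rewrite dB mxE iS.
have dA j : j \notin S -> \sum_i d 0 i * A i j = 0.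
  by move=> /negPf jS; have := mulB d j; rewrite dB mxE jS.
have d_ge0 i : 0 <= d 0 i.
  have [j _ jmin] := @Order.TotalTheory.arg_minP _ _ 'I_n i xpredT (fun i => d 0 i) isT.
  apply: le_trans (jmin i isT); rewrite leNgt; apply/negP => dj0.
  have jS : j \notin S by apply: contraTN dj0 => /d1 ->; rewrite ltr10.
  have : \sum_i d 0 i * A i j = \sum_i (d 0 i - d 0 j) * A i j + d 0 j * \sum_i A i j.
    by rewrite mulr_sumr -big_split; apply: eq_bigr => k _; rewrite /= -mulrDl subrK.
  rewrite dA // => /esym/eqP; rewrite addr_eq0 => /eqP E.
  have : 0 < d 0 j * \sum_i A i j by rewrite nmulr_rgt0.
  rewrite -oppr_lt0 -E ltNge sumr_ge0 // => k _.
  have [->|kj] := eqVneq k j; first by rewrite subrr mul0r.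
  by rewrite mulr_ge0 ?Aoff // subr_ge0 jmin.
exists (fun i => d 0 i); split=> // i; rewrite lt0r d_ge0 andbT; apply/negP => /eqP di0.
have [s0 s0I] := set0Pn _ I0; have /connectP [s ps ls] := conn i s0.
have : d 0 (last i s) = 0.
  elim: s i di0 ps {ls} => [|y s IH] x //= dx /andP[xy ps]; apply: IH ps.
  have xS : x \notin S by apply: contra_eqN dx => /d1 ->; rewrite oner_eq0.
  have xG : (x, y) \in G.
    by case/orP: xy => // /andP[xO _]; move: xS; rewrite inE xO orbT.
  have := dA x xS; rewrite (bigD1 x) //= dx mul0r add0r => /eqP.
  rewrite psumr_eq0 => [/allP /(_ y)|k kx]; last by rewrite mulr_ge0 ?Aoff.
  rewrite mem_index_enum => /(_ isT); have [-> //|yx] := eqVneq y x.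
  by rewrite mulf_eq0 (gt_eqF (Apos xG)) orbF => /eqP.
by rewrite -ls d1 ?inE ?s0I // => /eqP; rewrite oner_eq0.
Qed.

End BalancingWeights.

(** * Dimension and local identifiability *)

Section Models.
Variables (R : realType) (n : nat) (G : {set 'I_n * 'I_n}) (In Out : {set 'I_n}).
Hypothesis noloop : loopless G.
Hypothesis I0 : In != finset.set0.
Hypothesis O0 : Out != finset.set0.
Hypothesis conn : forall x y, connect (jump_rel G In Out) x y.
Local Notation S := (In :|: Out).
Local Notation VV := [set: 'I_n]%SET.

(** The compartmental matrix at the parameter p. *)
Definition compartmental_real (L : {set 'I_n}) (p : 'rV[R]_(nparam G L)) : 'M[R]_n :=
  map_mx (meval (fun u => p 0 u)) (compartmental_mx R G L).

Arguments compartmental_real L p : clear implicits.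

(** The real matrices which are compartmental for G with leaks in L. *)
Definition compartmental_pattern (L : {set 'I_n}) (A : 'M[R]_n) :=
  (forall i j, i != j -> (j, i) \notin G -> A i j = 0) /\
  (forall j, j \notin L -> \sum_i A i j = 0).

Lemma edge_param_out L e : e \notin G -> edge_param R G L e = 0.
Proof. by move=> eG; rewrite /edge_param insubF //; exact/negbTE. Qed.

Lemma leak_param_out (L : {set 'I_n}) i : i \notin L -> leak_param R G L i = 0.
Proof. by move=> iL; rewrite /leak_param insubF //; exact/negbTE. Qed.

Lemma compartmental_colsum L j : \sum_i compartmental_mx R G L i j = - leak_param R G L j.
Proof.
rewrite (bigD1 j) //= mxE eqxx.
rewrite [X in _ - X + _](_ : _ = \sum_(i | i != j) edge_param R G L (j, i)).
  have -> : \sum_(i | i != j) compartmental_mx R G L i j = \sum_(i | i != j) edge_param R G L (j, i).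
    by apply: eq_bigr => i ij; rewrite mxE (negPf ij).
  by rewrite subrK.
rewrite big_mkcond [RHS]big_mkcond; apply: eq_bigr => i _.
have [jG|jG] := boolP ((j, i) \in G).
  case: eqP => // E; by have := noloop j; rewrite -{2}E jG.
by rewrite edge_param_out //; case: ifP.
Qed.

Lemma compartmental_real_pattern L p : compartmental_pattern L (compartmental_real L p).
Proof.
split=> [i j ij jiG|j jL].
  by rewrite mxE mxE (negPf ij) edge_param_out // meval0.
transitivity (meval (fun u => p 0 u) (\sum_i compartmental_mx R G L i j)).
  by rewrite raddf_sum; apply: eq_bigr => i _; rewrite mxE.
by rewrite compartmental_colsum leak_param_out // oppr0 meval0.
Qed.

Lemma pattern_compartmental_real L A : compartmental_pattern L A -> exists p, A = compartmental_real L p.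
Proof.
move=> [Aoff Acol].
pose val_ (u : param G L) : R := match u with
  | inl e => A (val e).2 (val e).1
  | inr i => - \sum_k A k (val i) end.
exists (\row_u val_ (enum_val u)).
have evar u : meval (fun v => (\row_u val_ (enum_val u)) 0 v) (pvar R u) = val_ u.
  by rewrite mevalXU mxE enum_rankK.
have eedge i j : i != j -> meval (fun v => (\row_u val_ (enum_val u)) 0 v) (edge_param R G L (j, i)) = A i j.
  move=> ij; have [jiG|jiG] := boolP ((j, i) \in G).
    by rewrite (edge_paramE _ _ jiG) evar.
  by rewrite edge_param_out // meval0 Aoff.
apply/matrixP => i j; have [->|ij] := eqVneq i j; last by rewrite mxE mxE (negPf ij) eedge.
have cs : \sum_k compartmental_real L (\row_u val_ (enum_val u)) k j = \sum_k A k j.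
  transitivity (meval (fun v => (\row_u val_ (enum_val u)) 0 v) (\sum_i compartmental_mx R G L i j)).
    by rewrite raddf_sum; apply: eq_bigr => k _; rewrite mxE.
  rewrite compartmental_colsum mevalN; have [jL|jL] := boolP (j \in L).
    by rewrite /leak_param insubT evar opprK.
  by rewrite leak_param_out // meval0 oppr0 Acol.
move: cs; rewrite (bigD1 j) //= [RHS](bigD1 j) //= (eq_bigr (fun k => A k j)) => [/addIr //|k kj].
by rewrite mxE mxE (negPf kj) eedge.
Qed.

(** The coefficients named by l satisfy no polynomial relation on the matrices
    with leaks in L. *)
Definition label_indep (L : {set 'I_n}) d (l : 'I_d -> label n) :=
  forall Q : {mpoly R[d]}, (forall A, compartmental_pattern L A -> Q.@[fun i => char_coef A (l i)] = 0) -> Q = 0.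

(** The coefficient named by l, as a polynomial in the parameters. *)
Definition label_coef (L : {set 'I_n}) (l : label n) : ppoly R G L := char_coef (compartmental_mx R G L) l.

Lemma ev_label_coef L l p : ev (label_coef L l) p = char_coef (compartmental_real L p) l.
Proof. by rewrite /compartmental_real map_char_coef. Qed.

Lemma ev_eq0 N (P : {mpoly R[N]}) : (forall x, ev P x = 0) -> P = 0.
Proof.
move=> P0; apply: contrapT => /eqP nP.
by have [x _] := mpoly_nonzero_near 0 ltr01 nP; rewrite P0 eqxx.
Qed.

Lemma label_indepE L d (l : 'I_d -> label n) :
  label_indep L l <-> algindep (fun i => label_coef L (l i)).
Proof.
split=> H Q HQ; apply: H.
  move=> A /pattern_compartmental_real [p ->].
  transitivity (ev (subst (fun i => label_coef L (l i)) Q) p); last by rewrite HQ; exact: meval0.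
  by rewrite ev_subst; apply: meval_eq => i; rewrite ev_label_coef.
apply: ev_eq0 => p; rewrite ev_subst -[RHS](HQ _ (compartmental_real_pattern p)).
by apply: meval_eq => i; rewrite ev_label_coef.
Qed.

Lemma label_indep_subset (L L' : {set 'I_n}) d (l : 'I_d -> label n) :
  L \subset L' -> label_indep L l -> label_indep L' l.
Proof.
move=> LL' H Q HQ; apply: H => A [A1 A2]; apply: HQ; split=> // j jL'.
by apply: A2; apply: contra jL'; apply: (fintype.subsetP LL').
Qed.

(** A relation that holds with leaks in S holds at the positive parameters of the
    model with all leaks, hence everywhere. *)
Lemma label_indep_transfer d (l : 'I_d -> label n) :
  (forall i, valid_label In Out (l i)) -> label_indep VV l -> label_indep S l.
Proof.
move=> vl HV Q HQ; apply: (label_indepE VV l).1 => //; apply: contrapT => /eqP P0.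
(* All coordinates of p are in [1, 3], hence positive. *)
have [p pnear] := mpoly_nonzero_near (const_mx 2) ltr01 P0.
case/negP; rewrite ev_subst; apply/eqP.
have p0 u : 0 < p 0 u.
  have := le_trans (coord_le_norm _ u) pnear; rewrite !mxE ler_norml => /andP[]; lra.
set A := compartmental_real VV p.
have Aedge i j : (j, i) \in G -> 0 < A i j.
  move=> jiG; have ij : i != j by apply: contraTneq jiG => ->; exact: noloop.
  by rewrite mxE mxE (negPf ij) (edge_paramE _ _ jiG) mevalXU p0.
have Aoff i j : i != j -> 0 <= A i j.
  move=> ij; have [jiG|jiG] := boolP ((j, i) \in G); first by rewrite ltW // Aedge.
  by rewrite (compartmental_real_pattern p).1.
have Aleak j : \sum_i A i j < 0.
  have -> : \sum_i A i j = meval (fun v => p 0 v) (\sum_i compartmental_mx R G VV i j).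
    by rewrite raddf_sum; apply: eq_bigr => k _; rewrite mxE.
  by rewrite compartmental_colsum mevalN (leak_paramE _ _ (finset.in_setT j)) mevalXU oppr_lt0 p0.
have [d' [d0 d1 dA]] := balancing_weights Aedge Aoff Aleak I0 conn.
have dn0 i : d' i != 0 by rewrite gt_eqF.
pose A' := \matrix_(i, j) (d' i * A i j / d' j).
have patA' : compartmental_pattern S A'.
  split=> [i j ij jiG|j jS]; first by rewrite mxE (compartmental_real_pattern p).1 // mulr0 mul0r.
  transitivity ((\sum_i d' i * A i j) / d' j); last by rewrite dA // mul0r.
  by rewrite mulr_suml; apply: eq_bigr => i _; rewrite mxE.
rewrite -[RHS](HQ _ patA'); apply: meval_eq => i.
by rewrite ev_label_coef (char_coef_conj A dn0 d1).
Qed.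

Lemma mem_coefs L q : q \in coefs R G In Out L ->
  exists2 l, valid_label In Out l & q = label_coef L l.
Proof.
rewrite mem_filter => /andP[_ /flatten_mapP [j]]; rewrite mem_enum => jO.
rewrite mem_cat => /orP[/(nthP 0) [t _ <-]|/flatten_mapP [i]]; first by exists (inl t).
rewrite mem_enum => iI /(nthP 0) [t _ <-]; exists (inr (i, j, t)) => //=.
by rewrite iI jO.
Qed.

Lemma label_coef_mem L l : valid_label In Out l -> label_coef L l != 0 -> label_coef L l != 1 ->
  label_coef L l \in coefs R G In Out L.
Proof.
move=> vl l0 l1; rewrite mem_filter l0 l1 /=.
have nthmem (s : seq (ppoly R G L)) t : s`_t != 0 -> s`_t \in s.
  move=> st; apply: mem_nth; rewrite ltnNge; apply: contra st => st.
  by rewrite nth_default.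
case: l vl l0 {l1} => [t|[[i j] t]] /=.
  move=> _ /nthmem H; have [j jO] := set0Pn _ O0.
  by apply/flatten_mapP; exists j; rewrite ?mem_enum // mem_cat H.
move=> /andP[iI jO] /nthmem H; apply/flatten_mapP; exists j; rewrite ?mem_enum // mem_cat.
apply/orP; right; apply/flatten_mapP; exists i; first by rewrite mem_enum.
exact: H.
Qed.

(** Independence modulo the vanishing ideal of the image of the coefficient map is
    algebraic independence of the coefficients. *)
Lemma indep_coordinatesE L d (f : 'I_d -> 'I_(size (coefs R G In Out L))) :
  indep_coordinates (range (@Defs.coef_map R n G In Out L)) f <->
  algindep (fun i => coef_fam R G In Out L (f i)).
Proof.
split=> H Q HQ; apply: H.
  move=> _ [p _ <-].
  transitivity (ev (subst (fun i => coef_fam R G In Out L (f i)) Q) p).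
    by rewrite ev_subst; apply: meval_eq => i; rewrite mxE.
  by rewrite HQ; exact: meval0.
apply: ev_eq0 => p; rewrite ev_subst -[RHS](HQ (Defs.coef_map In Out p)).
  by apply: meval_eq => i; rewrite mxE.
by exists p.
Qed.

Lemma choose_labels L d (f : 'I_d -> 'I_(size (coefs R G In Out L))) :
  exists2 l : 'I_d -> label n, forall i, valid_label In Out (l i) &
    (fun i => coef_fam R G In Out L (f i)) =1 (fun i => label_coef L (l i)).
Proof.
have /choice [l lP] : forall i, exists l, valid_label In Out l /\ coef_fam R G In Out L (f i) = label_coef L l.
  by move=> i; have [l] := mem_coefs (mem_nth 0 (ltn_ord (f i))); exists l.
by exists l => i; [exact: (lP i).1|exact: (lP i).2].
Qed.

Lemma algindep_not_const N d (f : 'I_d -> {mpoly R[N]}) i c : algindep f -> f i != mpolyC N c.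
Proof.
move=> indf; apply/negP => /eqP fi.
have /eqP : 'X_i - mpolyC d c = 0 :> {mpoly R[d]}.
  by apply: indf; rewrite substB substX substC fi subrr.
rewrite subr_eq0 => /eqP /(congr1 (mcoeff (mnm1 i))).
rewrite mcoeffX eqxx mcoeffC mnm1_eq0 mulr0 => /eqP; by rewrite oner_eq0.
Qed.

Lemma choose_coefs L d (l : 'I_d -> label n) :
  (forall i, valid_label In Out (l i)) -> algindep (fun i => label_coef L (l i)) ->
  exists f : 'I_d -> 'I_(size (coefs R G In Out L)),
    algindep (fun i => coef_fam R G In Out L (f i)).
Proof.
move=> vl ind.
have /choice [f fP] : forall i, exists k : 'I_(size (coefs R G In Out L)), coef_fam R G In Out L k = label_coef L (l i).
  move=> i; have : label_coef L (l i) \in coefs R G In Out L.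
    apply: label_coef_mem => //.
      by have := algindep_not_const i 0 ind; rewrite mpolyC0.
    by have := algindep_not_const i 1 ind; rewrite mpolyC1.
  by move=> /(nthP 0) [k kl kE]; exists (Ordinal kl).
by exists f; apply: eq_algindep ind => i; rewrite fP.
Qed.

Hypothesis ident : identifiable_path_cycle_model R G In Out.
Local Notation NS := (#|G| + #|S|)%N.

Lemma label_indep_leq L d (l : 'I_d -> label n) : (forall i, valid_label In Out (l i)) ->
  label_indep L l -> (d <= NS)%N.
Proof.
move=> vl ind; rewrite -card_params.
apply: algindep_leq; apply: (label_indepE S l).1; apply: label_indep_transfer => //.
by apply: label_indep_subset ind; exact: finset.subsetT.
Qed.

Lemma max_label_indep : exists2 l : 'I_NS -> label n,
  forall i, valid_label In Out (l i) & label_indep S l.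
Proof.
have [r [f [indf rNS]]] := full_rank I0 O0 conn ident.
have [l vl fl] := choose_labels f.
have indV : label_indep VV l by apply: (label_indepE VV l).2; exact: eq_algindep indf.
have E : r = NS by apply/eqP; rewrite eqn_leq rNS (label_indep_leq vl indV).
move: l vl {fl} indV; rewrite E => l vl indV; exists l => //; exact: label_indep_transfer.
Qed.

Lemma expected_dimension_io (L : {set 'I_n}) : S \subset L -> expected_dimension R G In Out L.
Proof.
move=> SL; have [l vl ind] := max_label_indep; split.
  have [f indf] := choose_coefs vl ((label_indepE L l).1 (label_indep_subset SL ind)).
  by exists f; apply/indep_coordinatesE.
move=> d' f /indep_coordinatesE indf; have [l' vl' fl'] := choose_labels f.
apply: (label_indep_leq (L := L) vl'); apply: (label_indepE L l').2; exact: eq_algindep indf.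
Qed.

Lemma locally_identifiable_io : locally_identifiable R G In Out S.
Proof.
have [l vl ind] := max_label_indep.
have [f indf] := choose_coefs vl ((label_indepE S l).1 ind).
have [F [s [Fs sinj detF]]] := algindep_extend indf.
apply: null_measure_zero; apply: null_sub (mpoly_zero_null detF) => p /= np.
apply: contrapT => /eqP dp; apply: np.
have Du : dmap F p \in unitmx.
  rewrite unitmxE unitfE -det_tr; apply: contraNneq dp => <-.
  rewrite /ev -det_map_mx; apply/eqP; congr (\det _).
  by apply/matrixP => i j; rewrite !mxE.
have [del [L [del0 L0 H]]] := evmap_expansive (mulmxV Du).
exists (ball p del); first exact: nbhsx_ballx.
have UE x : ball p del x -> `|x - p| <= del.
  by rewrite -ball_normE /ball_ /= distrC => /ltW.
move=> q r /UE qd /UE rd Eqr.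
suff E : evmap F q = evmap F r.
  by have := H q r qd rd; rewrite E subrr normr0 mulr0 normr_le0 subr_eq0 => /eqP.
have sonto i : i \in codom s.
  by apply: inj_card_onto => //; rewrite !card_ord card_params.
apply/rowP => i; have /codomP [k ->] := sonto i; rewrite !mxE Fs.
by have /rowP /(_ (f k)) := Eqr; rewrite !mxE.
Qed.

End Models.

Theorem theorem3p19 (R : realType) (n : nat) (G : {set 'I_n * 'I_n})
    (In Out : {set 'I_n}) :
  loopless G -> In != finset.set0 -> Out != finset.set0 ->
  (strongly_io_connected G In Out /\ #|Out| = 1%N) \/
  (strongly_connected G /\ #|In| = 1%N) ->
  identifiable_path_cycle_model R G In Out ->
  (forall L : {set 'I_n}, In :|: Out \subset L ->
     expected_dimension R G In Out L) /\
  locally_identifiable R G In Out (In :|: Out).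
Proof.
move=> noloop I0 O0 hconn ident.
have conn : forall x y, connect (jump_rel G In Out) x y.
  by apply: jump_connected; case: hconn => [[? _]|[? _]]; [right|left].
split=> [L SL|]; first exact: expected_dimension_io.
exact: locally_identifiable_io.
Qed.
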